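(* Let $\gamma>0$ be a fixed constant. There is $q_4(\gamma)$ such that the following holds. Let $q\ge q_4(\gamma)$ be a prime, let $a,b$ be integers with $(a,q)=1$, let $f$ be any multiplicative function with $|f(n)|\le 1$ for all $n$, and let $x$ satisfy \[ \sqrt{q}\,(\log q)\,e^{(\log\log\log q)^{1+\gamma}}\le x\le q. \] Then \[ \Bigl|\sum_{\substack{n\le x\\ (n,q)=1}} f(n)\,e_q(an^{*}+bn)\Bigr|\;\le\; \frac{562\,x}{(\log\log\log q)^{\gamma}}. \]
   Context: $e_q(v)=e^{2\pi i v/q}$. For $(n,q)=1$, $n^{*}$ denotes an integer with $nn^{*}\equiv 1\pmod q$. The sum runs over positive integers $n\le x$ coprime to $q$. *)

(* Defs.v *)
From Stdlib Require Import Reals ZArith Znumtheory Bool.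
From Coquelicot Require Export Coquelicot.
Open Scope R_scope.

Definition e_q (q v : Z) : C :=
  (cos (2 * PI * IZR v / IZR q), sin (2 * PI * IZR v / IZR q)).

Definition multiplicative (f : nat -> C) : Prop :=
  f 1%nat = RtoC 1 /\
  forall m n : nat, Nat.gcd m n = 1%nat -> f (m * n)%nat = (f m * f n)%C.

Definition twisted_sum (f : nat -> C) (inv : Z -> Z) (q a b : Z) (x : R) : C :=
  sum_n (fun n : nat =>
           if andb (1 <=? n)%nat (Z.gcd (Z.of_nat n) q =? 1)%Z
           then (f n * e_q q (a * inv (Z.of_nat n) + b * Z.of_nat n))%C
           else RtoC 0)
        (Z.to_nat (Int_part x)).

Definition lll (q : Z) : R := ln (ln (ln (IZR q))).

(* Main.v *)
(** Proof idea.  The Weil bound is not used.  By the Turan-Kubilius inequality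
    almost every [n <= x] has about the expected number [L] of prime divisors in a
    window [2^j0, 2^j1) with [L = sum 1/p] of size [log log q], so the sum is governed by
    the bilinear sums of [f(p) f(m) e_q(a/(pm) + bpm)] over dyadic blocks of [p].
    Hoelder's inequality in [m] replaces [f(m)] by incomplete Kloosterman sums with
    parameters [lam = 1/p1 + 1/p2 - 1/p3 - 1/p4] and [mu = p1 + p2 - p3 - p4].
    In these one shifts [m] to [m + c v] and averages over [c <= A], [v <= B]:
    as [a lam/(m + c v) = (a lam/v) / (m/v + c)], the inner sum over [c] depends only
    on [r = m/v], [s = a lam/v] and, up to a small error, on [b mu v / q] rounded to
    a multiple of [1/A^2].  Hoelder with a large even exponent [2 l] then
    reduces everything to (i) the number of coincidences of [(r, s)], which is nearly
    diagonal because a vanishing alternating sum of eight reciprocals of small primes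
    must repeat every prime, and (ii) the complete moment over [r, s], which by
    orthogonality counts roots of rational functions.  As [lam] takes about [2^(4j)]
    values, a saving survives for every [x >= sqrt q]. *)

From HB Require Import structures.
From Stdlib Require Import Reals.
From mathcomp Require Import all_boot all_order all_algebra.
From mathcomp Require Import complex Rstruct.
From mathcomp Require Import ring lra zify.
Set Implicit Arguments. Unset Strict Implicit. Unset Printing Implicit Defensive.
Import Order.TTheory GRing.Theory Num.Theory Normc.
Local Open Scope ring_scope.
Local Open Scope complex_scope.

(** * Complex norms and moments of sums of reciprocals *)

(** The range of primes is squeezed from both sides. From above, clearing denominators in eight
    reciprocals of primes below 2^(j+1) must give an integer smaller than q, so j stays below about
    (log2 q)/8. From below, the 2l-th root in Hoelder's inequality returns a saving of 2^e only if
    2^(2 l e) is at most about 2^j, while A^l >= q with A about 2^(j/4) makes l at least about 4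
    (log2 q)/j; so j^2 has to exceed e log q. As up to log2 q dyadic blocks are added trivially,
    each must save more than log q, which makes e of order log log q. Starting at j of order (log
    q)^(3/4) satisfies this and still leaves w windows [i, 5 i) of exponents with w of order log log
    q, hence L of that order. The dominant loss is then the Turan-Kubilius error 1/sqrt(L): the
    bound reached is of size x / sqrt(log log q), and any fixed power of log log log q is smaller
    than this square root once q is large. *)

Section ComplexNorm.
Variable R : rcfType.
Implicit Types z : R[i].

Lemma normc_ge0 z : 0 <= normc z.
Proof. by case: z => a b; exact: sqrtr_ge0. Qed.

Lemma normcE_C z : (normc z)%:C = `|z|.
Proof. by rewrite normc_def; case: z. Qed.

Lemma normcJ_R z : normc z^* = normc z.
Proof. by apply: complexI; rewrite !normcE_C normcJ. Qed.

Lemma mulcJ z : z * z^* = (normc z ^+ 2)%:C.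
Proof. by rewrite -sqr_normc -normcE_C rmorphXn. Qed.

Lemma ler_normc_sum (I : Type) (r : seq I) (P : pred I) (F : I -> R[i]) :
  normc (\sum_(i <- r | P i) F i) <= \sum_(i <- r | P i) normc (F i).
Proof.
elim/big_ind2: _ => [|x1 x2 y1 y2 h1 h2|//]; first by rewrite normc0.
by apply: le_trans (le_normcD _ _) _; exact: lerD.
Qed.

Lemma normc_prod (I : Type) (r : seq I) (P : pred I) (F : I -> R[i]) :
  normc (\prod_(i <- r | P i) F i) = \prod_(i <- r | P i) normc (F i).
Proof. by elim/big_ind2: _ => [|x1 x2 y1 y2 <- <-|//]; [exact: normc1 | exact: normcM]. Qed.

Lemma prodr_le1 (I : finType) (F : I -> R) :
  (forall i, 0 <= F i <= 1) -> \prod_i F i <= 1.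
Proof.
move=> F01; apply: le_trans (_ : \prod_(i : I) 1 <= _); last by rewrite prodr_const expr1n.
by apply: ler_prod => i _; exact: F01.
Qed.

Lemma normc_sumX (T : finType) (z : T -> R[i]) (l : nat) :
  ((normc (\sum_t z t)) ^+ (2 * l))%:C =
  \sum_(h : {ffun bool * 'I_l -> T}) \prod_(i : bool * 'I_l) (if i.1 then (z (h i))^* else z (h i)).
Proof.
rewrite exprM rmorphXn /= -mulcJ rmorph_sum /=.
pose z' (b : bool) t := if b then (z t)^* else z t.
transitivity (\prod_(i : bool * 'I_l) \sum_t z' i.1 t); last first.
  by rewrite bigA_distr_bigA.
rewrite -(pair_bigA _ (fun b (_ : 'I_l) => \sum_t z' b t)) /=.
by rewrite big_bool /= !prodr_const card_ord exprMn mulrC.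
Qed.

End ComplexNorm.

(** The possibly degenerate assignments: every value occurs at least twice, so that the terms of a
    signed sum over h may cancel identically. *)
Definition repeats_values (I T : finType) (h : {ffun I -> T}) :=
  [forall i, exists j, (j != i) && (h j == h i)].

(** Such an h has at most l distinct values, since each one uses up two of the 2 l indices. Hence h
    factors through 'I_l, and there are |T|^l * l^(2 l) pairs of maps I -> 'I_l -> T. *)
Lemma card_repeats_values (I T : finType) (l : nat) : #|I| = (2 * l)%N ->
  (#|[set h : {ffun I -> T} | repeats_values h]| <= #|T| ^ l * l ^ (2 * l))%N.
Proof.
move=> cI.
case: (pickP (mem I)) => [i0 _|I0]; last first.
  have I00 : #|I| = 0%N by apply: eq_card0 => i; have := I0 i.
  have l0 : l = 0%N by lia.
  rewrite l0 /= muln0 !expn0 mulnn (leq_trans (max_card _)) //.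
  by rewrite card_ffun I00 expn0.
pose D : finType := ({ffun 'I_l -> T} * {ffun I -> 'I_l})%type.
pose f (p : D) : {ffun I -> T} := [ffun i => p.1 (p.2 i)].
suff sub : [set h : {ffun I -> T} | repeats_values h] \subset [set f p | p : D].
  apply: leq_trans (subset_leq_card sub) _.
  apply: leq_trans (leq_imset_card _ _) _.
  by rewrite card_prod !card_ffun card_ord cI.
apply/subsetP => h; rewrite inE => /forallP hno.
pose S := [set h i | i : I].
have cS : (#|S| <= l)%N.
  rewrite -(leq_pmul2l (ltn0Sn 1)) -cI.
  have -> : #|I| = (\sum_(t in S) \sum_(i | h i == t) 1)%N.
    by rewrite -sum1_card; apply: partition_big => i _; apply: imset_f.
  rewrite -sum1_card big_distrr /=; apply: leq_sum => t /imsetP [i _ ->].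
  have /existsP [j /andP [ji /eqP hj]] := hno i.
  by rewrite (bigD1 i) //= (bigD1 j) /= ?hj ?eqxx //= muln1.
have l0 : (0 < l)%N.
  by apply: leq_trans cS; apply/card_gt0P; exists (h i0); apply: imset_f.
have idx i : (index (h i) (enum S) < l)%N.
  apply: leq_trans cS; rewrite cardE index_mem mem_enum; exact: imset_f.
apply/imsetP; exists ([ffun x : 'I_l => nth (h i0) (enum S) x], [ffun i => Ordinal (idx i)]) => //.
apply/ffunP => i; rewrite !ffunE /= nth_index // mem_enum; exact: imset_f.
Qed.

(** * Zeros and complete moments of sums of reciprocals over a finite field *)

Section Roots.
Variable F : finFieldType.

(** Clear denominators: the numerator p has degree below |I| and does not vanish at - h i0, because
    only the i0-th factor vanishes there. As 1/0 = 0 in the field, a zero r may also be a pole of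
    some terms; multiplying p by the common denominator w catches these r too. *)
Lemma card_roots_recip (I : finType) (e h : I -> F) (i0 : I) :
  e i0 != 0 -> (forall j, j != i0 -> h j != h i0) ->
  (#|[set r : F | (\sum_i e i / (r + h i) == 0)%R]| <= 2 * #|I|)%N.
Proof.
move=> e0 hi0.
pose p : {poly F} := \sum_i e i *: \prod_(j | j != i) ('X + (h j)%:P).
pose w : {poly F} := \prod_i ('X + (h i)%:P).
have hornX (c r : F) : ('X + c%:P).[r] = r + c by rewrite !hornerE.
have Xn0 (c : F) : 'X + c%:P != 0 by rewrite -[c]opprK polyCN polyXsubC_eq0.
have p0 : p != 0.
  apply/negP => /eqP pe0; have : p.[- h i0] = 0 by rewrite pe0 horner0.
  rewrite horner_sum (bigD1 i0) //= [X in _ + X]big1 ?addr0 => [|i ii0]; last first.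
    rewrite hornerZ horner_prod (bigD1 i0) 1?eq_sym //= hornX.
    by rewrite addrC subrr mul0r mulr0.
  apply/eqP; rewrite hornerZ horner_prod mulf_neq0 //.
  by apply/prodf_neq0 => j ji0; rewrite hornX addrC subr_eq0 hi0.
have w0 : w != 0 by apply/prodf_neq0 => i _.
have szw : size w = #|I|.+1.
  have -> : w = \prod_(i <- enum I) ('X - (- h i)%:P).
    by rewrite big_enum; apply: eq_bigr => i _; rewrite polyCN opprK.
  by rewrite size_prod_XsubC -cardT.
have szp : (size p <= #|I|)%N.
  apply: leq_trans (size_sum _ _ _) _; apply/bigmax_leqP => i _.
  apply: leq_trans (size_scale_leq _ _) _.
  have -> : #|I| = #|predC1 i|.+1 by rewrite cardC1 prednK //; apply/card_gt0P; exists i.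
  rewrite (eq_bigl (mem (predC1 i))) ; last by move=> j; rewrite inE.
  under eq_bigr do rewrite -[h _]opprK polyCN.
  by rewrite -big_enum /= size_prod_XsubC -cardE.
have pw0 : p * w != 0 by rewrite mulf_neq0.
rewrite cardE; have : (size (enum [set r : F | (\sum_i e i / (r + h i) == 0)%R]) < size (p * w)%R)%N.
  apply: max_poly_roots => //; last exact: enum_uniq.
  apply/allP => r; rewrite mem_enum inE => /eqP sr.
  rewrite rootM; case: (boolP (root w r)) => [|wr]; first by rewrite orbT.
  rewrite orbF; apply/rootP.
  have rn i : r + h i != 0.
    move: wr; rewrite /root /w horner_prod => /prodf_neq0 /(_ i isT).
    by rewrite hornX.
  rewrite horner_sum -[RHS](mul0r (w.[r])) -[in RHS]sr.
  rewrite mulr_suml; apply: eq_bigr => i _; rewrite hornerZ -mulrA; congr (_ * _).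
  rewrite /w !horner_prod [in RHS](bigD1 i) //= hornX mulKf //.
rewrite size_mul // szw addnS /= => /ltnW hlt.
by apply: leq_trans hlt _; rewrite mul2n -addnn leq_add2r.
Qed.

End Roots.

Section Moment.
Variables (R : rcfType) (F : finFieldType) (psi : F -> R[i]).
Hypothesis psiD : forall x y, psi (x + y) = psi x * psi y.
Hypothesis psi1 : forall x, normc (psi x) = 1.
Hypothesis psi_orth : forall t, t != 0 -> \sum_s psi (s * t) = 0.

Let psi0 : psi 0 = 1.
Proof.
have n0 : psi 0 != 0.
  by apply/eqP => h; have := psi1 0; rewrite h normc0 => /esym/eqP; rewrite oner_eq0.
by apply: (mulfI n0); rewrite mulr1 -psiD addr0.
Qed.

Lemma char_conj x : (psi x)^* = psi (- x).
Proof.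
have n0 : psi x != 0.
  by apply/eqP => h; have := psi1 x; rewrite h normc0 => /esym/eqP; rewrite oner_eq0.
by apply: (mulfI n0); rewrite mulcJ psi1 expr1n -psiD subrr psi0.
Qed.

Lemma char_prod (I : finType) (f : I -> F) : \prod_i psi (f i) = psi (\sum_i f i).
Proof. by elim/big_rec2: _ => [|i y x _ ->]; rewrite ?psi0 ?psiD. Qed.

Lemma char_sum t : \sum_s psi (s * t) = (if t == 0 then #|F|%:R else 0).
Proof.
case: eqP => [->|/eqP /psi_orth //].
by under eq_bigr do rewrite mulr0 psi0; rewrite sumr_const.
Qed.

(** After expansion, the sum over s keeps exactly the pairs (r, h) with sum e_i / (r + g (h i)) = 0.
    An h whose values all repeat is charged with every r; any other h has a value taken once, which
    leaves at most 2 * (2 l) admissible r. *)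
Lemma moment_recip_le (T : finType) (z : T -> R[i]) (g : T -> F) (l : nat) :
  injective g -> (forall t, normc (z t) <= 1) ->
  \sum_r \sum_s (normc (\sum_t z t * psi (s / (r + g t)))) ^+ (2 * l) <=
  (#|F| * (#|F| * (#|T| ^ l * l ^ (2 * l)) + 4 * l * #|T| ^ (2 * l)))%N%:R.
Proof.
move=> ginj z1.
pose I := (bool * 'I_l)%type.
pose e (i : I) : F := if i.1 then -1 else 1.
have en0 i : e i != 0 by rewrite /e; case: ifP; rewrite ?oppr_eq0 oner_eq0.
pose zz (h : {ffun I -> T}) := \prod_(i : I) (if i.1 then (z (h i))^* else z (h i)).
have zz1 h : normc (zz h) <= 1.
  rewrite normc_prod; apply: prodr_le1 => i; rewrite normc_ge0 /=.
  by case: ifP => _; rewrite ?normcJ_R z1.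
pose E r (h : {ffun I -> T}) := \sum_i e i / (r + g (h i)).
have inner r : \sum_s (normc (\sum_t z t * psi (s / (r + g t)))) ^+ (2 * l) <=
   \sum_(h : {ffun I -> T}) (if E r h == 0 then #|F|%:R else 0).
  have {1}-> : \sum_s (normc (\sum_t z t * psi (s / (r + g t)))) ^+ (2 * l) =
     normc (\sum_s ((normc (\sum_t z t * psi (s / (r + g t)))) ^+ (2 * l))%:C).
    rewrite -rmorph_sum /= expr0n /= addr0 sqrtr_sqr ger0_norm //.
    by apply: sumr_ge0 => s _; rewrite exprn_ge0 // normc_ge0.
  have -> : \sum_s ((normc (\sum_t z t * psi (s / (r + g t)))) ^+ (2 * l))%:C =
     \sum_h zz h * (if E r h == 0 then #|F|%:R else 0).
    under eq_bigr do rewrite normc_sumX.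
    rewrite exchange_big /=; apply: eq_bigr => h _.
    rewrite -char_sum mulr_sumr; apply: eq_bigr => s _.
    rewrite /E mulr_sumr -char_prod -big_split /=; apply: eq_bigr => i _.
    rewrite /e; case: ifP => _; last by rewrite mul1r.
    by rewrite mulN1r mulrN -char_conj; exact: rmorphM.
  apply: le_trans (ler_normc_sum _ _ _) _; apply: ler_sum => h _.
  rewrite normcM; case: ifP => _; last by rewrite normc0 mulr0.
  have -> : normc (#|F|%:R : R[i]) = #|F|%:R.
    by rewrite -(rmorph_nat (real_complex R)) /= expr0n /= addr0 sqrtr_sqr ger0_norm.
  by rewrite ler_piMl.
apply: le_trans (ler_sum _ (fun r _ => inner r)) _.
rewrite exchange_big /=.
have -> : \sum_h \sum_r (if E r h == 0 then #|F|%:R else 0) =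
    (#|F| * \sum_(h : {ffun I -> T}) #|[set r | E r h == 0%R]|)%N%:R :> R.
  rewrite natrM natr_sum mulr_sumr; apply: eq_bigr => h _.
  rewrite -big_mkcond /= sumr_const cardsE mulr_natr.
  by congr (_ *+ _); apply: eq_card => r.
rewrite ler_nat leq_mul2l; apply/orP; right.
rewrite (bigID (fun h => repeats_values h)) /=; apply: leq_add.
  rewrite -[leqRHS]mulnC; have := @card_repeats_values I T l.
  rewrite card_prod card_bool card_ord => /(_ erefl) cno.
  apply: leq_trans (_ : \sum_(h : {ffun I -> T} | repeats_values h) #|F| <= _)%N.
    by apply: leq_sum => h _; exact: max_card.
  rewrite sum_nat_const leq_mul2r; apply/orP; right.
  by apply: leq_trans cno; rewrite cardsE; apply/eq_leq/eq_card.
apply: leq_trans (_ : \sum_(h : {ffun I -> T}) (4 * l) <= _)%N; last first.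
  by rewrite sum_nat_const card_ffun card_prod card_bool card_ord mulnC.
rewrite big_mkcond /=; apply: leq_sum => h _.
case: ifP => // /forallPn [i /existsPn hi].
apply: leq_trans (_ : 2 * #|{: bool * 'I_l}| <= _)%N; last by rewrite card_prod card_bool card_ord; lia.
apply: (@card_roots_recip _ _ _ (fun i => g (h i)) i) => // j ji.
by apply/eqP => /ginj hj; have := hi j; rewrite ji hj eqxx.
Qed.

End Moment.

(** * Coincidences and Hoelder's inequality *)

(** Clearing denominators gives an integer N that vanishes modulo q and is smaller than q in
    absolute value, so N = 0. Every term of N except the i-th contains the factor u i, so u i
    divides the product of the other primes and equals one of them. *)
Lemma recip_sum_eq0_repeat (q : nat) (I : finType) (e : I -> bool) (u : I -> nat) (X : nat) :
  prime q -> (forall i, prime (u i)) -> (forall i, (u i < X)%N) -> (X <= q)%N ->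
  (#|I| * X ^ #|I|.-1 < q)%N ->
  \sum_i (-1) ^+ e i / (u i)%:R = 0 :> 'F_q ->
  forall i, exists2 j, j != i & u j = u i.
Proof.
move=> pq pu uX Xq small sum0 i.
have un0 j : (u j)%:R != 0 :> 'F_q.
  rewrite -(dvdn_pcharf (pchar_Fp pq)); apply/negP => /dvdn_leq.
  by rewrite prime_gt0 // => /(_ isT); rewrite leqNgt (leq_trans (uX j)).
pose N : int := \sum_k (-1) ^+ e k * \prod_(j | j != k) (u j)%:Z.
have NF : N%:~R = 0 :> 'F_q.
  rewrite -[RHS](mulr0 (\prod_j (u j)%:R)) -[in RHS]sum0 /N rmorph_sum mulr_sumr /=.
  apply: eq_bigr => k _; rewrite rmorphM rmorphXn rmorphN1 rmorph_prod /=.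
  by rewrite [in RHS](bigD1 k) //= mulrAC mulrCA mulfV // mulr1 mulrC.
have Nsmall : (`|N| < q)%N.
  apply: leq_ltn_trans small.
  have : `|N| <= \sum_(k : I) (X ^ #|I|.-1)%N%:Z.
    apply: le_trans (ler_norm_sum _ _ _) _; apply: ler_sum => k _.
    rewrite normrM normrX normrN1 expr1n mul1r normr_prod.
    apply: le_trans (_ : \prod_(j | j != k) X%:Z <= _).
      by apply: ler_prod => j _; rewrite normr_ge0 /= ger0_norm // lez_nat ltnW.
    by rewrite prodr_const -rmorphXn /= lez_nat cardC1.
  by rewrite sumr_const -abszE -mulr_natl natz -PoszM lez_nat.
have N0 : N = 0.
  have : (q %| `|N|)%N.
    rewrite (dvdn_pcharf (pchar_Fp pq)); case: (N) NF => n; first by move=> /eqP.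
    by rewrite NegzE mulrNz abszN => /eqP; rewrite oppr_eq0.
  move/dvdn_leq => h; apply/eqP; rewrite -absz_eq0 -leqn0 leqNgt; apply/negP => /h.
  by rewrite leqNgt Nsmall.
have dv : (u i %| \prod_(j | j != i) u j)%N.
  have : ((u i)%:Z %| (-1) ^+ e i * \prod_(j | j != i) (u j)%:Z)%Z.
    have -> : (-1) ^+ e i * \prod_(j | j != i) (u j)%:Z =
       - \sum_(k | k != i) (-1) ^+ e k * \prod_(j | j != k) (u j)%:Z.
      by apply/eqP; rewrite -addr_eq0; move: N0; rewrite /N (bigD1 i) //= => ->.
    rewrite rpredN; apply: rpred_sum => k ki.
    rewrite (bigD1 i) 1?eq_sym //= mulrCA; exact: dvdz_mulr.
  rewrite dvdzE abszM abszX /= exp1n mul1n.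
  by rewrite -[X in (_ %| `|X|)%N](big_morph _ PoszM (erefl _ : Posz 1 = 1)).
have : exists2 j, j != i & (u i %| u j)%N.
  have := dv; rewrite -big_filter.
  have : forall j, j \in [seq j <- index_enum I | j != i] -> j != i.
    by move=> j; rewrite mem_filter => /andP [].
  elim: [seq _ <- _ | _] => [_|j s IH hs].
    by rewrite big_nil dvdn1 => /eqP u1; have := pu i; rewrite u1.
  rewrite big_cons Euclid_dvdM // => /orP [h|]; first by exists j => //; apply: hs; rewrite mem_head.
  by apply: IH => k ks; apply: hs; rewrite inE ks orbT.
case=> j ji d; exists j => //.
by move: d; rewrite dvdn_prime2 // => /eqP.
Qed.

Section Collisions.

Lemma card_coll (X Y K : finType) (f : X -> K) (g : Y -> K) :
  #|[set p : X * Y | f p.1 == g p.2]| = (\sum_k #|[set x | f x == k]| * #|[set y | g y == k]|)%N.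
Proof.
rewrite -sum1dep_card (eq_bigl (fun p : X * Y => xpredT p.1 && (f p.1 == g p.2))) //.
rewrite -(pair_big_dep xpredT (fun x y => f x == g y) (fun _ _ => 1%N)) /=.
rewrite (partition_big f xpredT) //=; apply: eq_bigr => k _.
rewrite -!sum1dep_card big_distrl /=; apply: eq_bigr => x /eqP ->.
by rewrite mul1n; apply: eq_bigl => y; rewrite eq_sym.
Qed.

(** This is 2 x y <= x^2 + y^2 in each fibre. It reduces coincidences between two different keys to
    coincidences of each key with itself. *)
Lemma card_coll_le (X K : finType) (f g : X -> K) :
  (2 * #|[set p : X * X | f p.1 == g p.2]| <=
   #|[set p : X * X | f p.1 == f p.2]| + #|[set p : X * X | g p.1 == g p.2]|)%N.
Proof.
rewrite !card_coll -big_split big_distrr /=; apply: leq_sum => k _.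
by rewrite !mulnn; exact: nat_Cauchy.
Qed.

Definition recip_sum (q : nat) (I U : finType) (e : I -> bool) (p : U -> nat)
    (h : {ffun I -> U}) : 'F_q := \sum_i (-1) ^+ e i / (p (h i))%:R.

(** Move the second sum to the left: the two assignments glue to one signed sum over I + I that
    vanishes, so every prime in it repeats and the count of repeating assignments applies. *)
Lemma card_recip_coll (q : nat) (I U : finType) (e : I -> bool) (p : U -> nat) (X : nat) :
  prime q -> injective p -> (forall u, prime (p u)) -> (forall u, (p u < X)%N) -> (X <= q)%N ->
  (2 * #|I| * X ^ (2 * #|I|).-1 < q)%N ->
  (#|[set hh : {ffun I -> U} * {ffun I -> U} |
       recip_sum q e p hh.1 == recip_sum q e p hh.2]| <=
     #|U| ^ #|I| * #|I| ^ (2 * #|I|))%N.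
Proof.
move=> pq pinj pp pX Xq small.
have cII : #|{: I + I}| = (2 * #|I|)%N by rewrite card_sum mul2n addnn.
apply: leq_trans (card_repeats_values U cII).
pose glue (hh : {ffun I -> U} * {ffun I -> U}) : {ffun I + I -> U} :=
  [ffun s => match s with inl i => hh.1 i | inr i => hh.2 i end].
have gI : injective glue.
  move=> [a b] [c d] /ffunP E; congr (_, _); apply/ffunP => i.
    by have := E (inl i); rewrite !ffunE.
  by have := E (inr i); rewrite !ffunE.
rewrite -(card_imset _ gI); apply: subset_leq_card; apply/subsetP => h /imsetP [hh].
rewrite inE => /eqP lE ->; rewrite inE; apply/forallP => i; apply/existsP.
pose e2 (s : I + I) := match s with inl i => e i | inr i => ~~ e i end.
have [||||s si ps] := @recip_sum_eq0_repeat q _ e2 (fun s => p (glue hh s)) X pq _ _ Xq _ _ i.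
- by move=> s; exact: pp.
- by move=> s; exact: pX.
- by rewrite cII.
- rewrite big_sumType /=; apply/eqP; rewrite addr_eq0; apply/eqP.
  transitivity (recip_sum q e p hh.1); first by apply: eq_bigr => k _; rewrite ffunE.
  rewrite lE /recip_sum -sumrN; apply: eq_bigr => k _; rewrite ffunE -mulNr.
  by case: (e k); rewrite /= ?expr1 ?expr0 ?opprK.
by exists s; rewrite si; apply/eqP/pinj.
Qed.

(** A dyadic harmonic sum: each block 2^s <= a < 2^(s+1) contributes at most M to the sum of M / a,
    and t blocks cover the range up to B. *)
Lemma card_dvd_pairs (M B t : nat) : (B < 2 ^ t)%N ->
  (#|[set p : 'I_M * 'I_B | (p.1.+1 * p.2.+1 <= M)%N]| <= M * t)%N.
Proof.
move=> Bt.
rewrite -sum1dep_card (eq_bigl (fun p : 'I_M * 'I_B => xpredT p.1 && (p.1.+1 * p.2.+1 <= M)%N)) //.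
rewrite -(pair_big_dep xpredT (fun (x : 'I_M) (y : 'I_B) => (x.+1 * y.+1 <= M)%N) (fun _ _ => 1%N)) /=.
rewrite (exchange_big_dep xpredT) //=.
apply: leq_trans (_ : \sum_(1 <= a < 2 ^ t) (M %/ a) <= _)%N.
  apply: leq_trans (_ : \sum_(1 <= a < B.+1) (M %/ a) <= _)%N; last first.
    by rewrite (@big_cat_nat _ _ _ B.+1 1 (2 ^ t)) //= leq_addr.
  rewrite big_add1 /= big_mkord; apply: leq_sum => y _.
  rewrite sum1dep_card.
  have inj : injective (fun x : 'I_(M %/ y.+1) => (x : nat)) by exact: val_inj.
  rewrite -[leqRHS]card_ord.
  case: (posnP (M %/ y.+1)) => [z|pos].
    rewrite z card_ord leqn0 cards_eq0; apply/eqP/setP => x; rewrite !inE.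
    apply/negP => h; suff : (0 < M %/ y.+1)%N by rewrite z.
    rewrite divn_gt0 //; apply: leq_trans h; exact: leq_pmull.
  have [w wE] : exists w, (M %/ y.+1)%N = w.+1 by exists (M %/ y.+1).-1; rewrite prednK.
  rewrite wE.
  pose f (x : 'I_M) : 'I_w.+1 := inord x.
  rewrite -(card_in_imset (f := f)); first exact: max_card.
  move=> x x'; rewrite !inE -!leq_divRL // !wE => hx hx' /(congr1 val) /=.
  by rewrite !inordK // => xx; apply: val_inj.
elim: (t) => [|s IH]; first by rewrite big_geq.
rewrite (@big_cat_nat _ _ _ (2 ^ s)) ?expn_gt0 ?leq_exp2l //= mulnS addnC leq_add //.
apply: leq_trans (_ : \sum_(2 ^ s <= a < 2 ^ s.+1) (M %/ 2 ^ s) <= _)%N.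
  rewrite big_nat [leqRHS]big_nat; apply: leq_sum => a /andP [sa _].
  by apply: leq_div2l => //; rewrite expn_gt0.
rewrite sum_nat_const_nat expnS mul2n -addnn addnK mulnC; exact: leq_trunc_div.
Qed.

(** Solutions of m v' = m' v are parametrised by m = g a, m' = g a', v = h a, v' = h a' with g =
    gcd(m, m'). Here g a <= M and h a' <= B, and both families of pairs are counted by divisors. *)
Lemma card_mul_coll (M B t : nat) : (B < 2 ^ t)%N ->
  (#|[set p : ('I_M * 'I_B) * ('I_M * 'I_B) |
       (p.1.1.+1 * p.2.2.+1 == p.2.1.+1 * p.1.2.+1)%N]| <= (M * t) * (B * t))%N.
Proof.
move=> Bt; case: M => [|M].
  by rewrite mul0n leqn0 cards_eq0; apply/eqP/setP => [[[[]]]].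
case: B Bt => [|B] Bt.
  by rewrite mul0n muln0 leqn0 cards_eq0; apply/eqP/setP => [[[? []]]].
have h1 := @card_dvd_pairs M.+1 B.+1 t Bt.
have h2 := @card_dvd_pairs B.+1 B.+1 t Bt.
apply: leq_trans (leq_mul h1 h2).
rewrite -cardsX.
(* The argument is ((g, a), (h, a')); an ordinal x stands for the positive integer x + 1, hence the
   successors and predecessors. *)
pose f (x : ('I_M.+1 * 'I_B.+1) * ('I_B.+1 * 'I_B.+1)) : ('I_M.+1 * 'I_B.+1) * ('I_M.+1 * 'I_B.+1) :=
  ((inord (x.1.1.+1 * x.1.2.+1).-1, inord (x.2.1.+1 * x.1.2.+1).-1),
   (inord (x.1.1.+1 * x.2.2.+1).-1, inord (x.2.1.+1 * x.2.2.+1).-1)).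
apply: leq_trans (leq_imset_card f _); apply: subset_leq_card; apply/subsetP.
move=> [[m v] [m' v']]; rewrite inE /= => /eqP E.
pose g := gcdn m.+1 m'.+1.
have g0 : (0 < g)%N by rewrite gcdn_gt0.
have [a aE] : exists a, (m.+1 = a * g)%N by apply/dvdnP; exact: dvdn_gcdl.
have [a' a'E] : exists a', (m'.+1 = a' * g)%N by apply/dvdnP; exact: dvdn_gcdr.
have a0 : (0 < a)%N by move: aE; case: (a).
have a'0 : (0 < a')%N by move: a'E; case: (a').
have co : coprime a a'.
  rewrite /coprime -(eqn_pmul2r g0) mul1n muln_gcdl -aE -a'E //.
have E2 : (a * v'.+1 = a' * v.+1)%N.
  by apply/eqP; rewrite -(eqn_pmul2r g0) mulnAC -aE mulnAC -a'E E.
have [h hE] : exists h, (v.+1 = h * a)%N.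
  by apply/dvdnP; rewrite -(Gauss_dvdr _ co) -E2 dvdn_mulr.
have h'E : (v'.+1 = h * a')%N.
  by apply/eqP; rewrite -(eqn_pmul2l a0) E2 hE; apply/eqP; ring.
have h0 : (0 < h)%N by move: hE; case: (h).
have mM := ltn_ord m; have vB := ltn_ord v; have m'M := ltn_ord m'; have v'B := ltn_ord v'.
have gM : (g <= M.+1)%N by apply: leq_trans mM; rewrite aE leq_pmull.
have aB : (a <= B.+1)%N by apply: leq_trans vB; rewrite hE leq_pmull.
have hB : (h <= B.+1)%N by apply: leq_trans vB; rewrite hE leq_pmulr.
have a'B : (a' <= B.+1)%N by apply: leq_trans v'B; rewrite h'E leq_pmull.
apply/imsetP; exists ((inord g.-1, inord a.-1), (inord h.-1, inord a'.-1)).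
  rewrite !inE /= !inordK ?prednK //=.
  by rewrite mulnC -aE mM -h'E v'B.
have gK : (inord g.-1 : 'I_M.+1).+1 = g by rewrite inordK prednK.
have aK : (inord a.-1 : 'I_B.+1).+1 = a by rewrite inordK prednK.
have hK : (inord h.-1 : 'I_B.+1).+1 = h by rewrite inordK prednK.
have a'K : (inord a'.-1 : 'I_B.+1).+1 = a' by rewrite inordK prednK.
by rewrite /f [_.1]/= [_.2]/= gK aK hK a'K (mulnC g a) (mulnC g a') -aE -a'E -hE -h'E /= !inord_val.
Qed.

Variable R : rcfType.

Lemma sum_CS (K : finType) (a b : K -> R) :
  (\sum_k a k * b k) ^+ 2 <= (\sum_k a k ^+ 2) * (\sum_k b k ^+ 2).
Proof.
have : 0 <= \sum_i \sum_j (a i * b j - a j * b i) ^+ 2.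
  by apply: sumr_ge0 => i _; apply: sumr_ge0 => j _; exact: sqr_ge0.
have -> : \sum_i \sum_j (a i * b j - a j * b i) ^+ 2 =
  \sum_i \sum_j (a i ^+ 2 * b j ^+ 2) + \sum_i \sum_j (a j ^+ 2 * b i ^+ 2)
   - 2 * \sum_i \sum_j (a i * b i * (a j * b j)).
  rewrite mulr_sumr -sumrN -!big_split /=; apply: eq_bigr => i _.
  rewrite mulr_sumr -sumrN -!big_split /=; apply: eq_bigr => j _.
  ring.
rewrite [X in _ + X - _]exchange_big /=.
have dist (f g : K -> R) : \sum_i \sum_j f i * g j = (\sum_i f i) * \sum_j g j.
  by rewrite mulr_suml; apply: eq_bigr => i _; rewrite mulr_sumr.
rewrite !(dist (fun i => a i ^+ 2) (fun j => b j ^+ 2)) (dist (fun i => a i * b i) (fun i => a i * b i)).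
rewrite expr2; lra.
Qed.

(** Group w by key: the second moment of the fibre sizes is the number of coincidences, and the
    remaining sum runs over all of K. This is the completion step. *)
Lemma key_CS (W K : finType) (k : W -> K) (g : K -> R) :
  (\sum_w g (k w)) ^+ 2 <= #|[set p : W * W | k p.1 == k p.2]|%:R * (\sum_i g i ^+ 2).
Proof.
have -> : \sum_w g (k w) = \sum_i #|[set w | k w == i]|%:R * g i.
  rewrite (partition_big k xpredT) //=; apply: eq_bigr => i _.
  rewrite mulr_natl -sumr_const big_set /=.
  by apply: eq_big => w; rewrite ?inE // => /eqP ->.
apply: le_trans (sum_CS _ _) _; rewrite ler_wpM2r ?sumr_ge0 // => [i _|]; first exact: sqr_ge0.
by rewrite card_coll natr_sum; apply: ler_sum => i _; rewrite natrM expr2.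
Qed.

(** g i - g j and g i ^+ n - g j ^+ n have the same sign; sum their products over i and j. *)
Lemma chebyshev_sum (W : finType) (g : W -> R) (n : nat) : (forall w, 0 <= g w) ->
  (\sum_w g w) * (\sum_w g w ^+ n) <= #|W|%:R * \sum_w g w ^+ n.+1.
Proof.
move=> g0.
have : 0 <= \sum_i \sum_j (g i - g j) * (g i ^+ n - g j ^+ n).
  apply: sumr_ge0 => i _; apply: sumr_ge0 => j _.
  case: (lerP (g j) (g i)) => h.
    by rewrite mulr_ge0 // subr_ge0 // lerXn2r // nnegrE.
  by rewrite mulr_le0 // subr_le0 ?(ltW h) // lerXn2r ?nnegrE // ltW.
have -> : \sum_i \sum_j (g i - g j) * (g i ^+ n - g j ^+ n) =
  \sum_i \sum_(j : W) g i ^+ n.+1 + \sum_(i : W) \sum_j g j ^+ n.+1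
   - (\sum_i \sum_j g i * g j ^+ n + \sum_i \sum_j g j * g i ^+ n).
  rewrite -!big_split /= -sumrB; apply: eq_bigr => i _.
  rewrite -!big_split /= -sumrB; apply: eq_bigr => j _.
  rewrite !exprS; ring.
rewrite [X in _ + X - _]exchange_big /= [X in _ - (_ + X)]exchange_big /=.
have -> : \sum_i \sum_(j : W) g i ^+ n.+1 = #|W|%:R * \sum_w g w ^+ n.+1.
  by rewrite mulr_sumr; apply: eq_bigr => i _; rewrite sumr_const mulr_natl.
have -> : \sum_i \sum_j g i * g j ^+ n = (\sum_w g w) * (\sum_w g w ^+ n).
  by rewrite mulr_suml; apply: eq_bigr => i _; rewrite mulr_sumr.
lra.
Qed.

Lemma power_mean (W : finType) (g : W -> R) (n : nat) : (forall w, 0 <= g w) ->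
  (\sum_w g w) ^+ n.+1 <= #|W|%:R ^+ n * \sum_w g w ^+ n.+1.
Proof.
move=> g0; elim: n => [|n IH]; first by rewrite mul1r.
rewrite exprS; apply: le_trans (ler_wpM2l _ IH) _; first exact: sumr_ge0.
by rewrite mulrCA exprSr -mulrA ler_wpM2l ?exprn_ge0 ?ler0n // chebyshev_sum.
Qed.

Lemma key_holder (W K : finType) (k : W -> K) (g : K -> R) (n : nat) : (forall i, 0 <= g i) ->
  (\sum_w g (k w)) ^+ (2 * n.+1) <=
  #|W|%:R ^+ (2 * n) * (#|[set p : W * W | k p.1 == k p.2]|%:R * \sum_i g i ^+ (2 * n.+1)).
Proof.
move=> g0; rewrite mulnC exprM.
apply: le_trans (_ : (#|W|%:R ^+ n * \sum_w g (k w) ^+ n.+1) ^+ 2 <= _).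
  rewrite lerXn2r ?nnegrE ?exprn_ge0 ?sumr_ge0 ?mulr_ge0 ?exprn_ge0 ?sumr_ge0 ?ler0n //; last exact: power_mean.
  by move=> i _; exact: exprn_ge0.
rewrite exprMn -exprM mulnC ler_wpM2l ?exprn_ge0 ?ler0n //.
apply: le_trans (key_CS k (fun i => g i ^+ n.+1)) _.
by rewrite ler_wpM2l ?ler0n //; apply: ler_sum => i _; rewrite -exprM mulnC.
Qed.

End Collisions.

(** * Additive characters *)

Local Notation R := Rdefinitions.R.

Definition expi (x : R) : R[i] := (cos (2 * PI * x)%R) +i* (sin (2 * PI * x)%R).
Arguments expi x%_ring_scope.

Lemma PI_pos : 0 < PI.
Proof. by apply/RltP; exact: PI_RGT_0. Qed.

Lemma expiD x y : expi (x + y) = expi x * expi y.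
Proof.
rewrite /expi mulrDr sinD cosD; apply/eqP; rewrite eq_complex /=.
by apply/andP; split; apply/eqP; ring.
Qed.

Lemma normc_expi x : normc (expi x) = 1.
Proof.
rewrite /expi /= -[RHS]sqrtr1; congr Num.sqrt.
by have := sin2_cos2 (2 * PI * x)%R; rewrite /Rsqr !RealsE addrC !expr2.
Qed.

Lemma expi0 : expi 0 = 1.
Proof. by rewrite /expi mulr0 cos_0 sin_0. Qed.

Lemma expi_nat n : expi n%:R = 1.
Proof.
elim: n => [|n IH]; first exact: expi0.
by rewrite -addn1 natrD expiD IH mul1r /expi mulr1 cos_2PI sin_2PI.
Qed.

Lemma abs_sin_le (x : R) : `|sin x| <= `|x|.
Proof.
wlog x0 : x / 0 <= x.
  move=> H; case: (lerP 0 x) => [|/ltW x0]; first exact: H.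
  have := H (- x); rewrite oppr_ge0 => /(_ x0).
  by rewrite (_ : sin (- x)%R = - sin x) ?normrN //; exact: sin_neg.
rewrite (ger0_norm x0) ler_norml.
move: x0; rewrite le_eqVlt => /orP [/eqP <-|x0].
  by rewrite sin_0 oppr0 lexx.
have /RltP h1 : Rlt (sin x) x by apply: sin_lt_x; apply/RltP.
rewrite (ltW h1) andbT.
case: (lerP x 2) => x2; last first.
  have [h _] := SIN_bound x; move/RleP: h => h.
  by apply: le_trans h; rewrite lerN2; apply: ltW; apply: lt_trans x2; rewrite ltr1n.
apply: le_trans (_ : 0 <= _); first by rewrite oppr_le0 ltW.
apply/RleP; apply: sin_ge_0; first by apply/RleP/ltW.
apply: Rle_trans (_ : Rle 2 _); first by apply/RleP.
by have := PI2_1; move=> h; apply: Rlt_le; Lra.lra.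
Qed.

(** By the sum-to-product formulas both coordinates differ by at most 2 |PI (x - y)|, and PI <= 4,
    whence 16 = 2 * 2 * 4. *)
Lemma expi_lip x y : normc (expi x - expi y) <= 16 * `|x - y|.
Proof.
pose d := PI * (x - y).
have piE z : 2 * PI * z = PI * z + PI * z by ring.
have normle (u v : R) : normc (u +i* v) <= `|u| + `|v|.
  rewrite /= -[leRHS]ger0_norm ?addr_ge0 // -sqrtr_sqr ler_wsqrtr //.
  rewrite sqrrD !real_normK ?num_real //.
  by have := mulr_ge0 (normr_ge0 u) (normr_ge0 v); lra.
have d8 : `|d| <= 4 * `|x - y|.
  rewrite /d normrM ler_wpM2r // ger0_norm; last by apply/RleP/Rlt_le/PI_RGT_0.
  by have /RleP := PI_4; rewrite IZRposE INRE.
have c1 : `|cos (2 * PI * x)%R - cos (2 * PI * y)%R| <= 2 * `|d|.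
  have -> : cos (2 * PI * x)%R - cos (2 * PI * y)%R = - 2 * (sin d * sin (PI * x + PI * y)%R).
    have := form2 (2 * PI * x)%R (2 * PI * y)%R; rewrite !RealsE => ->.
    rewrite -mulrA; congr (_ * (sin _ * sin _)); rewrite /d [nat_of_pos _]/=; lra.
  rewrite normrM normrN (ger0_norm (ler0n _ 2)) ler_wpM2l // normrM.
  apply: le_trans (_ : `|sin d| * 1 <= _); last by rewrite mulr1 abs_sin_le.
  rewrite ler_wpM2l // ler_norml.
  by have [/RleP h1 /RleP h2] := SIN_bound (PI * x + PI * y)%R; apply/andP.
have c2 : `|sin (2 * PI * x)%R - sin (2 * PI * y)%R| <= 2 * `|d|.
  have -> : sin (2 * PI * x)%R - sin (2 * PI * y)%R = 2 * (cos (PI * x + PI * y)%R * sin d).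
    have := form4 (2 * PI * x)%R (2 * PI * y)%R; rewrite !RealsE => ->.
    rewrite -mulrA; congr (_ * (cos _ * sin _)); rewrite /d [nat_of_pos _]/=; lra.
  rewrite normrM (ger0_norm (ler0n _ 2)) ler_wpM2l // normrM.
  apply: le_trans (_ : 1 * `|sin d| <= _); last by rewrite mul1r abs_sin_le.
  rewrite ler_wpM2r // ler_norml.
  by have [/RleP h1 /RleP h2] := COS_bound (PI * x + PI * y)%R; apply/andP.
apply: le_trans (normle _ _) _; lra.
Qed.

Section Psi.
Variables (q : nat) (pq : prime q).

Definition psi (x : 'F_q) : R[i] := expi ((x : nat)%:R / q%:R).

Let qn0 : (q%:R : R) != 0.
Proof. by rewrite pnatr_eq0 -lt0n prime_gt0. Qed.

Lemma psi_nat n : psi n%:R = expi (n%:R / q%:R).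
Proof.
rewrite /psi val_Fp_nat // [in RHS](divn_eq n q) natrD natrM mulrDl mulfK // expiD expi_nat.
by rewrite mul1r.
Qed.

Lemma psiD x y : psi (x + y) = psi x * psi y.
Proof.
have <- : ((x : nat) + (y : nat))%N%:R = x + y by rewrite natrD !natr_Zp.
by rewrite psi_nat natrD mulrDl expiD.
Qed.

Lemma normc_psi x : normc (psi x) = 1.
Proof. exact: normc_expi. Qed.

(** Translating s by 1 multiplies the full sum of [psi] by psi 1, which differs from 1: as q >= 2
    the angle 2 PI / q lies in (0, PI], where the cosine is below 1. *)
Lemma psi_orth t : t != 0 -> \sum_s psi (s * t) = 0.
Proof.
move=> t0.
have -> : \sum_s psi (s * t) = \sum_s psi s.
  rewrite [RHS](reindex (fun s => s * t)) //=.
  by exists (fun s => s / t) => s _; rewrite ?mulfK ?mulfVK.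
have h : psi 1 * \sum_s psi s = \sum_s psi s.
  rewrite mulr_sumr [RHS](reindex (fun s => 1 + s)) /=.
    by apply: eq_bigr => s _; rewrite psiD.
  by exists (fun s => s - 1) => s _; ring.
have n1 : psi 1 != 1.
  have a0 : 0 < 2 * PI / q%:R :> R.
    by apply: divr_gt0; [apply: mulr_gt0 PI_pos; exact: ltr0n | rewrite ltr0n prime_gt0].
  have -> : (1 : 'F_q) = 1%N%:R by [].
  rewrite psi_nat mul1r /expi eq_complex /= negb_and; apply/orP; left.
  rewrite neq_lt; apply/orP; left.
  rewrite -[X in _ < X]cos_0; apply/RltP; apply: cos_decreasing_1.
  - exact: Rle_refl.
  - by apply/Rlt_le/PI_RGT_0.
  - by apply/RleP; rewrite ltW.
  - apply/RleP; rewrite ler_pdivrMr ?ltr0n ?prime_gt0 //.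
    by rewrite [leRHS]mulrC; apply: ler_wpM2r; [exact: ltW PI_pos | rewrite ler_nat prime_gt1].
  - exact/RltP.
apply/eqP; move/eqP: h; rewrite -subr_eq0 -{2}[\sum_s _]mul1r -mulrBl mulf_eq0 subr_eq0.
by rewrite (negbTE n1).
Qed.

End Psi.

Lemma shift_sum (G : nat -> R[i]) (M t : nat) : (forall n, normc (G n) <= 1) ->
  normc (\sum_(m < M) G m.+1 - \sum_(m < M) G (m.+1 + t)%N) <= (2 * t)%N%:R.
Proof.
move=> G1; elim: t => [|t IH].
  rewrite muln0; under [X in _ - X]eq_bigr do rewrite addn0.
  by rewrite subrr normc0.
rewrite -(subrKA (\sum_(m < M) G (m.+1 + t)%N)).
apply: le_trans (le_normcD _ _) _.
rewrite mulnS addnC natrD lerD // -sumrB.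
have -> : \sum_(m < M) (G (m.+1 + t)%N - G (m.+1 + t.+1)%N) = G (1 + t)%N - G (M.+1 + t)%N.
  rewrite -opprB -(@telescope_sumr _ 0 M (fun m => G (m.+1 + t)%N)) // big_mkord -sumrN.
  by apply: eq_bigr => m _; rewrite opprB addnS.
by apply: le_trans (le_normcD _ _) _; rewrite normcN (_ : 2%:R = 1 + 1) // lerD.
Qed.

(** * Shifted incomplete Kloosterman sums *)

Lemma sum_widen_le (M M' : nat) (le : (M' <= M)%N) (f : 'I_M -> R) :
  (forall m, 0 <= f m) -> \sum_(m < M') f (widen_ord le m) <= \sum_(m < M) f m.
Proof.
move=> f0.
have inj : injective (widen_ord le) by move=> x y /(congr1 val) /= ?; exact: val_inj.
have -> : \sum_(m < M') f (widen_ord le m) = \sum_(m in widen_ord le @: setT) f m.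
  by rewrite big_imset => [|x y _ _]; [apply: eq_bigl => m; rewrite inE | exact: inj].
by rewrite [leRHS](bigID (mem (widen_ord le @: setT))) /= lerDl sumr_ge0.
Qed.

Section Core.
Variables (q : nat) (pq : prime q) (U : finType) (p : U -> nat) (a b : 'F_q) (A B M : nat).
Hypotheses (a0 : a != 0) (A0 : (0 < A)%N) (Bq : (B < q)%N).

(** The value true marks p3 and p4, the primes from the conjugated factors of the fourth power. So
    [lam] is 1/p1 + 1/p2 - 1/p3 - 1/p4 and [lin_sum] is the corresponding mu. *)
Definition sgn4 (i : bool * 'I_2) : bool := i.1.
Definition lin_sum (h : {ffun bool * 'I_2 -> U}) : 'F_q := \sum_i (-1) ^+ sgn4 i * (p (h i))%:R.
Local Notation lam := (recip_sum q sgn4 p).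
Definition kloo_phase (h : {ffun bool * 'I_2 -> U}) (k : nat) : R[i] :=
  psi (a * lam h / k%:R + b * lin_sum h * k%:R).

Let q0 : (0 < q)%N. Proof. exact: prime_gt0. Qed.

(* Rounding [w / q] down to a multiple of [1 / A ^ 2] leaves only [A ^ 2] linear phases. *)
Lemma floor_key_proof (w : 'F_q) : ((w * A ^ 2) %/ q < A ^ 2)%N.
Proof.
rewrite ltn_divLR // mulnC ltn_pmul2l ?expn_gt0 ?A0 //.
by have := ltn_ord w; rewrite [X in (_ < X)%N -> _](Fp_cast pq).
Qed.
Definition floor_key (w : 'F_q) : 'I_(A ^ 2) := Ordinal (floor_key_proof w).

Definition short_sum (x : 'F_q * 'F_q * 'I_(A ^ 2)) : R :=
  normc (\sum_(c < A) expi (x.2%:R * c.+1%:R / (A ^ 2)%:R) * psi (x.1.2 / (x.1.1 + c.+1%:R))).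

Definition shift_key (w : {ffun bool * 'I_2 -> U} * ('I_M * 'I_B)) : 'F_q * 'F_q * 'I_(A ^ 2) :=
  ((w.2.1.+1%:R / w.2.2.+1%:R, a * lam w.1 / w.2.2.+1%:R),
   floor_key (b * lin_sum w.1 * w.2.2.+1%:R)).

Lemma natF_neq0 k : (0 < k < q)%N -> k%:R != 0 :> 'F_q.
Proof.
case/andP=> k0 kq; rewrite -(dvdn_pcharf (pchar_Fp pq)).
by apply/negP => /dvdn_leq; rewrite k0 leqNgt kq => /(_ isT).
Qed.

(** Rounding moves w / q by less than 1 / A^2; the factor c <= A and the Lipschitz constant 16 turn
    this into 16 / A. Over A values of c the total error is the constant 16. *)
Lemma expi_floor (w : 'F_q) (c : nat) : (c <= A)%N ->
  normc (psi (w * c%:R) - expi ((floor_key w : nat)%:R * c%:R / (A ^ 2)%:R)) <= 16 / A%:R.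
Proof.
move=> cA.
have Ap : (0 : R) < A%:R by rewrite ltr0n.
have qp : (0 : R) < q%:R by rewrite ltr0n.
have -> : w * c%:R = (w * c)%N%:R by rewrite natrM natr_Zp.
rewrite psi_nat //; apply: le_trans (expi_lip _ _) _.
rewrite ler_wpM2l // natrM natrX /=.
set j := (_ %/ _)%N.
have E : (w%:R * A%:R ^+ 2 = j%:R * q%:R + ((w * A ^ 2) %% q)%N%:R :> R).
  by rewrite -natrX -!natrM -natrD -divn_eq.
set r := (_ %% _)%N in E.
have rq : r%:R < q%:R :> R by rewrite ltr_nat ltn_pmod.
have -> : w%:R * c%:R / q%:R - j%:R * c%:R / A%:R ^+ 2 = c%:R * r%:R / (q%:R * A%:R ^+ 2) :> R.
  have -> : w%:R = (j%:R * q%:R + r%:R) / A%:R ^+ 2 :> R by rewrite -E mulfK // expf_neq0 // gt_eqF.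
  by field; rewrite !gt_eqF.
rewrite ger0_norm; last by rewrite divr_ge0 ?mulr_ge0 ?ler0n ?exprn_ge0.
rewrite ler_pdivrMr ?mulr_gt0 ?exprn_gt0 //.
have -> : A%:R^-1 * (q%:R * A%:R ^+ 2) = A%:R * q%:R :> R by field; rewrite gt_eqF.
by apply: ler_pM; rewrite ?ler0n ?(ltW rq) // ler_nat.
Qed.

(** B < q makes v invertible, so v can be taken out of the denominator m + c v. With 1/0 = 0 the
    identity also holds where m + c v vanishes modulo q. *)
Lemma kloo_shift (h : {ffun bool * 'I_2 -> U}) (m : 'I_M) (v : 'I_B) (c : nat) :
  kloo_phase h (m.+1 + c * v.+1) =
  psi (b * lin_sum h * m.+1%:R) *
  (psi (b * lin_sum h * v.+1%:R * c%:R) * psi ((a * lam h / v.+1%:R) / (m.+1%:R / v.+1%:R + c%:R))).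
Proof.
have v0 : v.+1%:R != 0 :> 'F_q by rewrite natF_neq0 //= (leq_ltn_trans (ltn_ord v)).
rewrite -!psiD // /kloo_phase; congr (psi _).
rewrite addrA [RHS]addrC natrD natrM; congr (_ + _); last by ring.
have -> : m.+1%:R / v.+1%:R + c%:R = (m.+1%:R + c%:R * v.+1%:R) / v.+1%:R :> 'F_q.
  by rewrite mulrDl mulfK.
by rewrite invfM invrK [_^-1 * v.+1%:R]mulrC mulrA mulfVK.
Qed.

Lemma kloo_shift_le (h : {ffun bool * 'I_2 -> U}) (m : 'I_M) (v : 'I_B) :
  normc (\sum_(c < A) kloo_phase h (m.+1 + c.+1 * v.+1)) <= short_sum (shift_key (h, (m, v))) + 16.
Proof.
have -> : \sum_(c < A) kloo_phase h (m.+1 + c.+1 * v.+1) = psi (b * lin_sum h * m.+1%:R) *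
  (\sum_(c < A) (psi (b * lin_sum h * v.+1%:R * c.+1%:R) *
     psi ((a * lam h / v.+1%:R) / (m.+1%:R / v.+1%:R + c.+1%:R)))).
  by rewrite mulr_sumr; apply: eq_bigr => c _; exact: kloo_shift.
rewrite normcM normc_psi mul1r /short_sum.
set S := (X in normc X <= _); set S' := (X in _ <= normc X + _).
have -> : S = S' + (S - S') by rewrite addrC subrK.
apply: le_trans (le_normcD _ _) _; rewrite lerD2l /S /S' -sumrB.
apply: le_trans (ler_normc_sum _ _ _) _.
apply: le_trans (_ : _ <= \sum_(c < A) (16 / A%:R)) _.
  apply: ler_sum => c _; rewrite -mulrBl normcM normc_psi mulr1.
  exact: (@expi_floor (b * lin_sum h * v.+1%:R) c.+1 (ltn_ord c)).
by rewrite sumr_const card_ord -[_ *+ A]mulr_natr mulfVK // pnatr_eq0 -lt0n.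
Qed.

(** Each of the A B shifts by c v <= A B changes the sum by at most 2 A B. The range of m is widened
    from M' to M only after norms are taken, when all terms are nonnegative; thus the bound is
    uniform in M'. *)
Lemma kloo_sum_le (h : {ffun bool * 'I_2 -> U}) (M' : nat) : (M' <= M)%N ->
  (A * B)%:R * normc (\sum_(m < M') kloo_phase h m.+1) <=
  \sum_(w : 'I_M * 'I_B) (short_sum (shift_key (h, w)) + 16) + (2 * (A * B) ^ 2)%N%:R.
Proof.
move=> M'M.
set T := \sum_(m < M') _.
have n1 k : normc (kloo_phase h k) <= 1 by rewrite normc_psi.
pose T' := \sum_(c < A) \sum_(v < B) \sum_(m < M') kloo_phase h (m.+1 + c.+1 * v.+1).
have E : (A * B)%:R * T = T' + \sum_(c < A) \sum_(v < B) (T - \sum_(m < M') kloo_phase h (m.+1 + c.+1 * v.+1)).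
  rewrite /T' -big_split /=.
  under eq_bigr => c _ do (rewrite -big_split /=; under eq_bigr => v _ do rewrite addrC subrK).
  rewrite !sumr_const !card_ord -mulrnA mulr_natl mulnC //.
have nN k : normc (k%:R : R[i]) = k%:R.
  by rewrite -(rmorph_nat (real_complex R)) /= expr0n /= addr0 sqrtr_sqr ger0_norm.
rewrite -nN -normcM E; apply: le_trans (le_normcD _ _) _; apply: lerD.
  have -> : T' = \sum_(m < M') \sum_(v < B) \sum_(c < A) kloo_phase h (m.+1 + c.+1 * v.+1).
    rewrite /T' exchange_big [RHS]exchange_big /=; apply: eq_bigr => v _.
    by rewrite exchange_big.
  apply: le_trans (ler_normc_sum _ _ _) _.
  apply: le_trans (_ : \sum_(m < M') \sum_(v < B) (short_sum (shift_key (h, (widen_ord M'M m, v))) + 16) <= _).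
    apply: ler_sum => m _; apply: le_trans (ler_normc_sum _ _ _) _.
    by apply: ler_sum => v _; exact: (kloo_shift_le h (widen_ord M'M m) v).
  have pos m : 0 <= \sum_(v < B) (short_sum (shift_key (h, (m, v))) + 16).
    by apply: sumr_ge0 => v _; rewrite addr_ge0 // normc_ge0.
  rewrite -(pair_bigA _ (fun m v => short_sum (shift_key (h, (m, v))) + 16)) /=.
  exact: (sum_widen_le M'M pos).
apply: le_trans (ler_normc_sum _ _ _) _.
apply: le_trans (_ : \sum_(c < A) \sum_(v < B) (2 * (A * B))%N%:R <= _).
  apply: ler_sum => c _; apply: le_trans (ler_normc_sum _ _ _) _.
  apply: ler_sum => v _; apply: le_trans (shift_sum _ _ n1) _.
  by rewrite ler_nat leq_mul2l leq_mul.
by rewrite !sumr_const !card_ord -mulrnA -mulrnA ler_nat; lia.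
Qed.

End Core.

(** Serves to turn the joint truncation of m by four primes, which is preserved when m decreases,
    into an initial segment. *)
Lemma prefix_pred (c : nat -> bool) (M : nat) : (forall m, c m.+1 -> c m) ->
  exists2 M', (M' <= M)%N & forall m, (m < M)%N -> c m = (m < M')%N.
Proof.
move=> cS; have down m k : (k <= m)%N -> c m -> c k.
  by move=> /subnK <-; elim: (m - k)%N => // i IH; rewrite addSn => /cS.
elim: M => [|M [M' M'M IH]]; first by exists 0%N.
case cM: (c M).
  exists M.+1 => // m; rewrite ltnS => mM.
  by rewrite (down _ _ mM cM) mM.
exists M'; first exact: leqW.
move=> m; rewrite ltnS leq_eqVlt => /orP [/eqP ->|/IH //].
by rewrite cM ltnNge M'M.
Qed.

(** * Bilinear sums over primes and cofactors *)

Section Bilinear.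
Variables (q : nat) (pq : prime q) (U : finType) (p : U -> nat) (a b : 'F_q) (A B M n t X Q : nat).
Hypotheses (a0 : a != 0) (A0 : (0 < A)%N) (B0 : (0 < B)%N) (Aq : (A < q)%N) (Bq : (B < q)%N).
Hypotheses (pinj : injective p) (pp : forall u, prime (p u)) (pX : forall u, (p u < X)%N).
Hypotheses (Xq : (X <= q)%N) (Xsmall : (8 * X ^ 7 < q)%N).
Hypotheses (MB : (M * B < q)%N) (Bt : (B < 2 ^ t)%N) (UQ : (#|U| <= Q)%N).
Local Notation H4 := {ffun bool * 'I_2 -> U}.
Local Notation l := n.+1.
Local Notation lam := (recip_sum q sgn4 p).

(** For each of the A^2 rounding classes the linear phase is a coefficient of modulus 1, so the
    complete moment bound applies; A < q keeps the shifts c distinct modulo q. *)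
Lemma sum_short_sum_moment :
  \sum_x @short_sum q A x ^+ (2 * l) <=
  (A ^ 2 * (q * (q * (A ^ l * l ^ (2 * l)) + 4 * l * A ^ (2 * l))))%N%:R.
Proof.
have q0 : (0 < q)%N := prime_gt0 pq.
rewrite -(pair_bigA _ (fun x j => @short_sum q A (x, j) ^+ (2 * l))) /= exchange_big /=.
apply: le_trans (_ : \sum_(j < A ^ 2) (q * (q * (A ^ l * l ^ (2 * l)) + 4 * l * A ^ (2 * l)))%N%:R <= _); last first.
  by rewrite sumr_const card_ord -mulrnA mulnC.
apply: ler_sum => j _.
rewrite -(pair_bigA _ (fun r s => @short_sum q A (r, s, j) ^+ (2 * l))) /=.
have inj : injective (fun c : 'I_A => c.+1%:R : 'F_q).
  move=> c d /(congr1 (fun x : 'F_q => x : nat)); rewrite !val_Fp_nat // !modn_small.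
  - by move=> [cd]; apply: val_inj.
  - exact: leq_ltn_trans (ltn_ord d) Aq.
  - exact: leq_ltn_trans (ltn_ord c) Aq.
have := @moment_recip_le _ _ (@psi q) (psiD pq) (@normc_psi q) (psi_orth pq) _
  (fun c : 'I_A => expi ((j : nat)%:R * c.+1%:R / (A ^ 2)%:R)) _ l inj.
rewrite card_Fp // card_ord; apply.
by move=> c; rewrite normc_expi.
Qed.

(** Equal r gives m v' = m' v modulo q, hence in the integers as M B < q. For each such quadruple,
    equality of the s components is compared with the case v = v', where it says lam = lam'; this is
    the collision of 2 * 4 reciprocals, whose smallness condition is 8 X^7 < q. The rounded
    component is dropped. *)
Lemma card_shift_key_coll :
  (#|[set w : (H4 * ('I_M * 'I_B)) * (H4 * ('I_M * 'I_B)) |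
       shift_key pq p a b A0 w.1 == shift_key pq p a b A0 w.2]| <=
   (M * t) * (B * t) * (Q ^ 4 * 4 ^ 8))%N.
Proof.
have c4 : #|{: bool * 'I_2}| = 4%N by rewrite card_prod card_bool card_ord.
have nz (v : 'I_B) : v.+1%:R != 0 :> 'F_q.
  by apply: natF_neq0 => //=; apply: leq_ltn_trans Bq; exact: ltn_ord.
pose D := [set x : ('I_M * 'I_B) * ('I_M * 'I_B) | (x.1.1.+1 * x.2.2.+1 == x.2.1.+1 * x.1.2.+1)%N].
have hD := card_mul_coll M Bt; rewrite -/D in hD.
apply: leq_trans (_ : \sum_(x in D) #|[set hh : H4 * H4 |
   (a * lam hh.1 / x.1.2.+1%:R == a * lam hh.2 / x.2.2.+1%:R)%R]| <= _)%N.
  rewrite -!sum1dep_card.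
  rewrite (reindex (fun z : (H4 * H4) * (('I_M * 'I_B) * ('I_M * 'I_B)) =>
     ((z.1.1, z.2.1), (z.1.2, z.2.2)))) /=; last first.
    exists (fun w => ((w.1.1, w.2.1), (w.1.2, w.2.2))); first by case=> [[? ?] [? ?]].
    by case=> [[? ?] [? ?]].
  rewrite (eq_bigl (fun z => xpredT z.1 && (shift_key pq p a b A0 (z.1.1, z.2.1) == shift_key pq p a b A0 (z.1.2, z.2.2)))) //.
  rewrite -(pair_big_dep xpredT (fun h x => shift_key pq p a b A0 (h.1, x.1) == shift_key pq p a b A0 (h.2, x.2)) (fun _ _ => 1%N)) /=.
  rewrite (exchange_big_dep (mem D)) /=; last first.
    move=> h x _ /eqP [/eqP r _ _]; rewrite inE.
    have : (x.1.1.+1 * x.2.2.+1)%N%:R == (x.2.1.+1 * x.1.2.+1)%N%:R :> 'F_q.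
      by rewrite !natrM -eqr_div.
    move=> /eqP /(congr1 (fun y : 'F_q => y : nat)); rewrite !val_Fp_nat // !modn_small => [/eqP //||].
      by apply: leq_ltn_trans MB; rewrite leq_mul.
    by apply: leq_ltn_trans MB; rewrite leq_mul.
  apply: leq_sum => x _; rewrite -sum1dep_card.
  rewrite big_mkcond [leqRHS]big_mkcond; apply: leq_sum => h _.
  case: eqP => // E.
  by have -> : (a * lam h.1 / x.1.2.+1%:R == a * lam h.2 / x.2.2.+1%:R)%R
    by apply/eqP; exact: (congr1 (fun z => z.1.2) E).
apply: leq_trans (_ : \sum_(x in D) Q ^ 4 * 4 ^ 8 <= _)%N; last first.
  by rewrite sum_nat_const leq_mul2r hD orbT.
apply: leq_sum => x _.
have E0 := @card_recip_coll q _ _ sgn4 p X pq pinj pp pX Xq.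
rewrite c4 in E0; have {}E0 := E0 Xsmall.
apply: leq_trans (_ : #|[set hh : H4 * H4 | lam hh.1 == lam hh.2]| <= _)%N; last first.
  apply: leq_trans E0 _; rewrite leq_mul2r leq_exp2r // UQ orbT //.
rewrite -(leq_pmul2l (ltn0Sn 1)) [leqRHS]mul2n -addnn.
apply: leq_trans (card_coll_le (fun h : H4 => a * lam h / x.1.2.+1%:R) (fun h : H4 => a * lam h / x.2.2.+1%:R)) _.
have inj (v : 'I_B) : #|[set hh : H4 * H4 | (a * lam hh.1 / v.+1%:R == a * lam hh.2 / v.+1%:R)%R]| =
   #|[set hh : H4 * H4 | lam hh.1 == lam hh.2]|.
  apply: eq_card => hh; rewrite !inE.
  by rewrite (inj_eq (mulIf (invr_neq0 (nz v)))) (inj_eq (mulfI a0)).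
by rewrite !inj.
Qed.

Variable e : nat.
Hypotheses (Aq_pow : (q <= A ^ l)%N) (A4Q : (A ^ 4 <= Q)%N) (qMB : (q <= 8 * Q ^ 2 * A ^ 2 * (M * B))%N).
Hypothesis Qbig : (40 * 4 ^ 8 * t ^ 2 * 2 ^ (2 * l * e) <= Q)%N.

(** With K = Q^4 M B, Hoelder leaves K^(2 l - 2) times coincidences times moment. So it suffices
    that coincidences times moment, divided by (A l)^(2 l), is at most K^2 / 2^(2 l e). *)
Lemma sum_short_sum_le :
  \sum_(w : H4 * ('I_M * 'I_B)) @short_sum q A (shift_key pq p a b A0 w) <=
  (A * B * Q ^ 4 * M)%N%:R * (l%:R / 2 ^+ e).
Proof.
set Y := \sum_w _.
have Y0 : 0 <= Y by apply: sumr_ge0 => w _; exact: normc_ge0.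
have H := @key_holder R _ _ (@shift_key q pq U p a b A B M A0) (@short_sum q A) n (fun x => normc_ge0 _).
rewrite -/Y in H.
rewrite -(@ler_pXn2r _ (2 * l)) ?nnegrE ?mulr_ge0 ?invr_ge0 ?exprn_ge0 ?ler0n //.
apply: le_trans H _.
have c4 : #|{: bool * 'I_2}| = 4%N by rewrite card_prod card_bool card_ord.
have [K KE] : exists K, K = (Q ^ 4 * (M * B))%N by exists (Q ^ 4 * (M * B))%N.
have cO : #|{: H4 * ('I_M * 'I_B)}|%:R ^+ (2 * n) <= (K ^ (2 * n))%N%:R :> R.
  rewrite natrX; apply: lerXn2r; rewrite ?nnegrE ?ler0n // ler_nat.
  by rewrite KE !card_prod card_ffun c4 !card_ord leq_mul2r leq_exp2r // UQ orbT.
apply: le_trans (_ : (K ^ (2 * n) * ((M * t) * (B * t) * (Q ^ 4 * 4 ^ 8) *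
  (A ^ 2 * (q * (q * (A ^ l * l ^ (2 * l)) + 4 * l * A ^ (2 * l))))))%N%:R <= _).
  rewrite natrM; apply: ler_pM; rewrite ?exprn_ge0 ?mulr_ge0 ?ler0n //.
    by apply: sumr_ge0 => x _; rewrite exprn_ge0 // normc_ge0.
  rewrite natrM; apply: ler_pM; rewrite ?ler0n ?ler_nat ?card_shift_key_coll ?sum_short_sum_moment //.
  by apply: sumr_ge0 => x _; rewrite exprn_ge0 // normc_ge0.
rewrite mulrA -natrM expr_div_n -exprM -!natrX ler_pdivlMr ?ltr0n ?expn_gt0 // -natrM ler_nat.
have -> : (A * B * Q ^ 4 * M * l = A * l * K)%N by rewrite KE; ring.
rewrite !expnMn [X in (_ <= _ * K ^ X)%N]mulnS expnD.
(* Since q <= A^l, the degenerate part of the moment is no larger than l^(2 l) A^(2 l); with the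
   weight 4 of the generic part this makes 5. *)
have h1 : (q * (A ^ l * l ^ (2 * l)) + 4 * l * A ^ (2 * l) <= 5 * (l ^ (2 * l) * A ^ (2 * l)))%N.
  have l1 : (l <= l ^ (2 * l))%N by rewrite -{1}[l]expn1 leq_pexp2l.
  have : (q * (A ^ l * l ^ (2 * l)) <= l ^ (2 * l) * A ^ (2 * l))%N.
    by rewrite mulnA mulnC leq_mul2l [X in (_ <= A ^ X)%N]mul2n -addnn expnD leq_mul2r Aq_pow !orbT.
  have : (4 * l * A ^ (2 * l) <= 4 * (l ^ (2 * l) * A ^ (2 * l)))%N.
    by rewrite -mulnA leq_mul2l /= leq_mul2r l1 orbT.
  lia.
apply: leq_trans (_ : K ^ (2 * n) * (M * t * (B * t) * (Q ^ 4 * 4 ^ 8) * (A ^ 2 * (q * (5 * (l ^ (2 * l) * A ^ (2 * l)))))) * 2 ^ (e * (2 * l)) <= _)%N.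
  by rewrite leq_mul2r leq_mul2l !leq_mul2l h1 !orbT.
(* Replacing q by 8 Q^2 A^2 M B leaves (M B)^2 Q^6 times two quantities, A^4 and the left side of
   [Qbig]; each is at most Q. *)
have h2 : (M * t * (B * t) * (Q ^ 4 * 4 ^ 8) * (A ^ 2 * (q * 5)) * 2 ^ (e * (2 * l)) <= K ^ 2)%N.
  apply: leq_trans (_ : M * t * (B * t) * (Q ^ 4 * 4 ^ 8) * (A ^ 2 * (8 * Q ^ 2 * A ^ 2 * (M * B) * 5)) * 2 ^ (e * (2 * l)) <= _)%N.
    by rewrite leq_mul2r leq_mul2l leq_mul2l leq_mul2r qMB !orbT.
  have -> : (M * t * (B * t) * (Q ^ 4 * 4 ^ 8) * (A ^ 2 * (8 * Q ^ 2 * A ^ 2 * (M * B) * 5)) * 2 ^ (e * (2 * l)) =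
    (M * B) ^ 2 * Q ^ 6 * (A ^ 4 * (40 * 4 ^ 8 * t ^ 2 * 2 ^ (2 * l * e))))%N.
    by rewrite (mulnC e); ring.
  have -> : (K ^ 2 = (M * B) ^ 2 * Q ^ 6 * (Q * Q))%N by rewrite KE; ring.
  by rewrite leq_mul2l leq_mul // orbT.
have -> : (K ^ (2 * n) * (M * t * (B * t) * (Q ^ 4 * 4 ^ 8) *
   (A ^ 2 * (q * (5 * (l ^ (2 * l) * A ^ (2 * l)))))) * 2 ^ (e * (2 * l)) =
   A ^ (2 * l) * l ^ (2 * l) * (M * t * (B * t) * (Q ^ 4 * 4 ^ 8) * (A ^ 2 * (q * 5)) * 2 ^ (e * (2 * l))
   * K ^ (2 * n)))%N by ring.
by rewrite leq_mul2l leq_mul2r h2 !orbT.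
Qed.

Hypothesis A2B : (A * A * B <= M)%N.

(** The 18 is 16 + 2: rounding costs 16 / A relative to the trivial bound, and shifting costs 2 A B
    / M <= 2 / A by A^2 B <= M. *)
Lemma kloo_prefix_le (c : H4 -> nat -> bool) : (forall h m, c h m.+1 -> c h m) ->
  \sum_h normc (\sum_(m < M | c h m) kloo_phase p a b h m.+1) <=
  (Q ^ 4 * M)%N%:R * (l%:R / 2 ^+ e + 18 / A%:R).
Proof.
move=> cS.
have AB0 : (0 : R) < (A * B)%:R by rewrite ltr0n muln_gt0 A0.
rewrite -(ler_pM2l AB0) mulr_sumr.
have c4 : #|{: bool * 'I_2}| = 4%N by rewrite card_prod card_bool card_ord.
apply: le_trans (_ : \sum_(h : H4) (\sum_(w : 'I_M * 'I_B) (@short_sum q A (shift_key pq p a b A0 (h, w)) + 16)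
    + (2 * (A * B) ^ 2)%N%:R) <= _).
  apply: ler_sum => h _.
  have [M' M'M cE] := prefix_pred M (cS h).
  rewrite (eq_bigl (fun m : 'I_M => (m < M')%N)); last by move=> m; rewrite cE.
  have := kloo_sum_le pq p b a0 A0 Bq h M'M.
  by rewrite (big_ord_widen M (fun m => kloo_phase p a b h m.+1) M'M).
rewrite big_split /= sumr_const card_ffun c4.
under eq_bigr do rewrite big_split /= sumr_const.
rewrite big_split /= sumr_const card_ffun c4.
rewrite (pair_bigA _ (fun h w => @short_sum q A (shift_key pq p a b A0 (h, w)))) /=.
have -> : \sum_(x : H4 * ('I_M * 'I_B)) @short_sum q A (shift_key pq p a b A0 (x.1, x.2)) =
   \sum_(w : H4 * ('I_M * 'I_B)) @short_sum q A (shift_key pq p a b A0 w) by apply: eq_bigr => [[? ?]].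
have UQ4 : (#|U| ^ 4 <= Q ^ 4)%N by rewrite leq_exp2r.
rewrite mulrDr mulrDr -addrA lerD //.
  by apply: le_trans sum_short_sum_le _; rewrite [leRHS]mulrA -natrM mulnA.
have Ap : (0 : R) < A%:R by rewrite ltr0n.
have -> : #|(xpredT : pred ('I_M * 'I_B))| = (M * B)%N by rewrite card_prod !card_ord.
rewrite -mulrnDl -mulrnA -natrD -mulrnA 2!mulrA -natrM ler_pdivlMr // -!natrM ler_nat.
have h1 : (M * B * #|U| ^ 4 * A <= M * B * A * Q ^ 4)%N.
  by rewrite -mulnA [(#|U| ^ 4 * A)%N]mulnC mulnA leq_mul2l UQ4 orbT.
have h2 : ((A * B) ^ 2 * #|U| ^ 4 * A <= A * B * M * Q ^ 4)%N.
  apply: leq_trans (_ : (A * B) * (A * A * B) * Q ^ 4 <= _)%N.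
    by rewrite (_ : (A * B) ^ 2 * #|U| ^ 4 * A = (A * B) * (A * A * B) * #|U| ^ 4)%N; [rewrite leq_mul2l UQ4 orbT | ring].
  by rewrite leq_mul2r leq_mul2l A2B !orbT.
have -> : ((16 * (M * B) + 2 * (A * B) ^ 2) * #|U| ^ 4 * A =
  16 * (M * B * #|U| ^ 4 * A) + 2 * ((A * B) ^ 2 * #|U| ^ 4 * A))%N by ring.
have -> : (A * B * (Q ^ 4 * M * 18) = 16 * (M * B * A * Q ^ 4) + 2 * (A * B * M * Q ^ 4))%N by ring.
by apply: leq_add; rewrite leq_mul2l ?h1 ?h2.
Qed.

Lemma bilinear_le (al : U -> R[i]) (be : nat -> R[i]) (X0 : nat) :
  (forall u, normc (al u) <= 1) -> (forall m, normc (be m) <= 1) ->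
  normc (\sum_u \sum_(m < M | (p u * m.+1 <= X0)%N)
    al u * be m.+1 * psi (a / (p u * m.+1)%:R + b * (p u * m.+1)%:R)) ^+ 4 <=
  (Q * M)%N%:R ^+ 4 * (l%:R / 2 ^+ e + 18 / A%:R).
Proof.
move=> al1 be1.
pose g (m : nat) u : R[i] := if (p u * m.+1 <= X0)%N then
  al u * psi (a / (p u * m.+1)%:R + b * (p u * m.+1)%:R) else 0.
set S := \sum_u _.
have -> : S = \sum_(m < M) be m.+1 * \sum_u g m u.
  rewrite /S (eq_bigr (fun u => \sum_(m < M) be m.+1 * g m u)) => [|u _].
    by rewrite exchange_big /=; apply: eq_bigr => m _; rewrite mulr_sumr.
  rewrite big_mkcond /=; apply: eq_bigr => m _; rewrite /g.
  by case: ifP => _; rewrite ?mulr0 // mulrA (mulrC (be _)).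
apply: le_trans (_ : (\sum_(m < M) normc (\sum_u g m u)) ^+ 4 <= _).
  rewrite lerXn2r ?nnegrE ?normc_ge0 ?sumr_ge0 // => [m _|]; first exact: normc_ge0.
  apply: le_trans (ler_normc_sum _ _ _) _; apply: ler_sum => m _.
  by rewrite normcM ler_piMl // normc_ge0.
apply: le_trans (power_mean 3 (fun m => normc_ge0 _)) _.
rewrite card_ord.
have -> : (Q * M)%N%:R ^+ 4 * (l%:R / 2 ^+ e + 18 / A%:R) =
   M%:R ^+ 3 * ((Q ^ 4 * M)%N%:R * (l%:R / 2 ^+ e + 18 / A%:R)) :> R.
  by rewrite !natrM; ring.
rewrite ler_wpM2l ?exprn_ge0 ?ler0n //.
(* The truncation p m <= X0 sits inside [g], so the expanded fourth power carries one condition for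
   each of the four primes; together they are closed downwards in m. *)
pose c (h : H4) (m : nat) := [forall i, (p (h i) * m.+1 <= X0)%N].
have cS h m : c h m.+1 -> c h m.
  move=> /forallP hc; apply/forallP => i; apply: leq_trans (hc i).
  by rewrite leq_mul2l leqnSn orbT.
apply: le_trans (kloo_prefix_le cS).
pose co (h : H4) : R[i] := \prod_i (if i.1 then (al (h i))^* else al (h i)).
have co1 h : normc (co h) <= 1.
  rewrite normc_prod; apply: prodr_le1 => i; rewrite normc_ge0 /=.
  by case: ifP => _; rewrite ?normcJ_R al1.
have gE (m : nat) : ((normc (\sum_u g m u)) ^+ 4)%:C =
   \sum_h (if c h m then co h * kloo_phase p a b h m.+1 else 0).
  rewrite (normc_sumX (g m) 2); apply: eq_bigr => h _.
  case: ifP => [/forallP hc|/forallPn [i hi]]; last first.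
    rewrite (bigD1 i) //= /g (negbTE hi); case: ifP => _; last by rewrite mul0r.
    by rewrite rmorph0 mul0r.
  have -> : kloo_phase p a b h m.+1 = \prod_i (psi ((-1) ^+ sgn4 i *
      (a / (p (h i) * m.+1)%:R + b * (p (h i) * m.+1)%:R))).
    rewrite (char_prod (psiD pq) (@normc_psi q)); congr (psi _).
    rewrite /recip_sum /lin_sum !mulr_sumr !mulr_suml -big_split /=.
    apply: eq_bigr => i _; rewrite !natrM invfM; ring.
  rewrite /co -big_split /=; apply: eq_bigr => i _.
  rewrite /g hc /sgn4; case: (i.1); last by rewrite mul1r.
  rewrite mulN1r -(char_conj (psiD pq) (@normc_psi q)); exact: rmorphM.
have -> : \sum_(m < M) normc (\sum_u g m u) ^+ 4 =
   normc (\sum_(m < M) ((normc (\sum_u g m u)) ^+ 4)%:C).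
  rewrite -rmorph_sum /= expr0n /= addr0 sqrtr_sqr ger0_norm //.
  by apply: sumr_ge0 => m _; rewrite exprn_ge0 // normc_ge0.
under eq_bigr do rewrite gE.
rewrite exchange_big /=; apply: le_trans (ler_normc_sum _ _ _) _.
apply: ler_sum => h _; rewrite -big_mkcond -mulr_sumr normcM.
by rewrite ler_piMl // normc_ge0.
Qed.

End Bilinear.

(** * Dyadic blocks *)

Lemma succ_mul_le y z : (0 < y)%N -> (y.+1 * z <= 2 * (z * y))%N.
Proof.
move=> y0; have -> : (2 * (z * y) = (2 * y) * z)%N by ring.
by rewrite leq_mul2r mul2n -addnn -addn1 leq_add2l y0 orbT.
Qed.

Section Block.
Variables (q : nat) (pq : prime q) (a b : 'F_q) (X k j e d t : nat) (al be : nat -> R[i]).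
Hypotheses (a0 : a != 0) (al1 : forall n, normc (al n) <= 1) (be1 : forall n, normc (be n) <= 1).
Hypotheses (Xq : (X <= q)%N) (qX : (q <= X ^ 2)%N) (qt : (q < 2 ^ t)%N).
Hypotheses (k0 : (0 < k)%N) (j6 : (6 <= j)%N) (qk : (q <= 2 ^ (j * k))%N) (jq : (2 ^ (7 * j + 11) <= q)%N).
Hypotheses (big1 : (40 * 4 ^ 8 * t ^ 2 * 2 ^ (16 * k * e) <= 2 ^ j)%N).
Hypotheses (big2 : (16 * k * 2 ^ (4 * d) <= 2 ^ e)%N) (big3 : (36 * 2 ^ (4 * d) <= 2 ^ (j %/ 4))%N).

(* [A ^ 4 <= Q] pays for the [A ^ 2] rounding classes and the loss in [B], and [A ^ (8 * k) >= q]
   makes the diagonal dominate the moment.  The second term in [B] ensures [M * B < q], so that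
   congruences between products [m * v] modulo [q] are equalities. *)
Let Q := (2 ^ j)%N.
Let A := (2 ^ (j %/ 4))%N.
Let M := (X %/ Q)%N.
Let B := minn (M %/ (A * A)) (q %/ (2 * M)).

Let Q0 : (0 < Q)%N. Proof. by rewrite expn_gt0. Qed.
Let A0 : (0 < A)%N. Proof. by rewrite expn_gt0. Qed.
Let A4Q : (A ^ 4 <= Q)%N.
Proof. by rewrite /A /Q -expnM leq_exp2l // leq_trunc_div. Qed.
Let Q7 : (8 * (2 * Q) ^ 7 < q)%N.
Proof.
apply: leq_trans jq.
have -> : (8 * (2 * Q) ^ 7 = 2 ^ (3 + j.+1 * 7))%N by rewrite /Q -expnS -expnM (expnD 2 3).
by rewrite ltn_exp2l //; clear; lia.
Qed.
Let Q_lt_q : (2 * Q < q)%N.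
Proof.
apply: leq_ltn_trans Q7; apply: leq_trans (_ : (2 * Q) ^ 7 <= _)%N; last exact: leq_pmull.
by rewrite -{1}[(2 * Q)%N]expn1 leq_pexp2l // muln_gt0 Q0.
Qed.
Let AQ : (A * A <= Q)%N.
Proof.
apply: leq_trans A4Q; rewrite mulnn; apply: leq_pexp2l => //.
Qed.
Let QQX : (Q ^ 3 < X)%N.
Proof.
rewrite -(@ltn_exp2r _ _ 2) //; apply: leq_trans qX; apply: leq_ltn_trans Q7.
rewrite -expnM; apply: leq_trans (_ : Q ^ 7 <= _)%N; first exact: leq_pexp2l.
apply: leq_trans (_ : (2 * Q) ^ 7 <= _)%N; last exact: leq_pmull.
by rewrite leq_exp2r // leq_pmull.
Qed.
Let QM : (Q ^ 2 <= M)%N.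
Proof. by rewrite leq_divRL // -expnSr ltnW. Qed.
Let M0 : (0 < M)%N. Proof. by apply: leq_trans QM; rewrite expn_gt0 Q0. Qed.
Let Q2 : (2 <= Q)%N.
Proof. by rewrite -{1}[2%N]expn1 leq_exp2l //; apply: leq_trans j6. Qed.
Let AM : (A * A <= M)%N.
Proof. by apply: leq_trans AQ _; apply: leq_trans QM; rewrite -{1}[Q]expn1 leq_pexp2l. Qed.
Let M2q : (2 * M <= q)%N.
Proof.
apply: leq_trans Xq; apply: leq_trans (leq_trunc_div X Q).
by rewrite mulnC leq_mul2l Q2 orbT.
Qed.
Let B0 : (0 < B)%N.
Proof. by rewrite leq_min !divn_gt0 ?muln_gt0 ?A0 ?M0 // AM M2q. Qed.
Let MBq : (M * B < q)%N.
Proof.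
apply: leq_ltn_trans (_ : M * (q %/ (2 * M)) < q)%N; first by rewrite leq_mul2l geq_minr orbT.
have := leq_trunc_div q (2 * M); have : (0 < q)%N := prime_gt0 pq.
set z := (_ %/ _)%N => q0 h.
have : (2 * (M * z) <= q)%N by rewrite (_ : 2 * (M * z) = z * (2 * M))%N //; ring.
move: (M * z)%N => [|y] //; rewrite mul2n -addnn; apply: leq_trans.
by rewrite -[X in (X < _)%N]addn0 ltn_add2l.
Qed.
Let Bq : (B < q)%N.
Proof. by apply: leq_ltn_trans MBq; exact: leq_pmull. Qed.
Let A2B : (A * A * B <= M)%N.
Proof.
apply: leq_trans (leq_trunc_div M (A * A)); rewrite mulnC leq_mul2r.
by rewrite geq_minl orbT.
Qed.
Let Aq : (A < q)%N.
Proof.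
apply: leq_ltn_trans Q_lt_q; apply: leq_trans (leq_pmull _ _) => //.
by apply: leq_trans AQ; exact: leq_pmull.
Qed.
Let XM : (X <= 2 * M * Q)%N.
Proof.
have := ltn_ceil X Q0; rewrite -/M => h; apply: ltnW; apply: leq_trans h _.
by rewrite leq_mul2r mul2n -addnn -addn1 leq_add2l M0 orbT.
Qed.
(** If B = M / A^2 rounded down, then M <= 2 A^2 B and q <= X^2 <= 4 Q^2 M^2; this is where X >=
    sqrt q enters. Otherwise M B >= q / 4 already. *)
Let qMB : (q <= 8 * Q ^ 2 * A ^ 2 * (M * B))%N.
Proof.
rewrite /B; case: (leqP (M %/ (A * A)) (q %/ (2 * M))) => _.
  have h : (M <= 2 * (A * A * (M %/ (A * A))))%N.
    have h := ltn_ceil M (_ : 0 < A * A)%N; rewrite muln_gt0 A0 in h; have {}h := ltnW (h isT).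
    by apply: leq_trans h _; apply: succ_mul_le; rewrite divn_gt0 ?muln_gt0 ?A0 // AM.
  apply: leq_trans qX _; apply: leq_trans (_ : (2 * M * Q) ^ 2 <= _)%N; first by rewrite leq_exp2r.
  set y := (M %/ _)%N in h *.
  apply: leq_trans (_ : 4 * Q ^ 2 * (M * (2 * (A * A * y))) <= _)%N.
    by rewrite (_ : (2 * M * Q) ^ 2 = 4 * Q ^ 2 * (M * M))%N; [rewrite !leq_mul2l h !orbT | ring].
  by apply: eq_leq; ring.
set y := (q %/ _)%N.
have y0 : (0 < y)%N by rewrite divn_gt0 ?muln_gt0 ?M0.
have h : (q <= 4 * (M * y))%N.
  have h := ltn_ceil q (_ : 0 < 2 * M)%N; rewrite muln_gt0 M0 in h; have {}h := ltnW (h isT).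
  by apply: leq_trans h _; rewrite (_ : 4 * (M * y) = 2 * (2 * M * y))%N; [exact: succ_mul_le | rewrite !mulnA].
apply: leq_trans h _; rewrite leq_mul2r; apply/orP; right.
rewrite -mulnA; apply: leq_trans (_ : 8 * 1 <= _)%N => //.
by rewrite leq_mul2l /= muln_gt0 !expn_gt0.
Qed.
(** The moment exponent is l = 8 k, twice what j / 4 without rounding would need; the doubling
    absorbs the floor, as j <= 8 (j %/ 4). *)
Let n := (8 * k).-1.
Let nE : n.+1 = (8 * k)%N. Proof. by rewrite prednK // muln_gt0. Qed.
Let Aqn : (q <= A ^ n.+1)%N.
Proof.
apply: leq_trans qk _; rewrite /A -expnM leq_exp2l // nE mulnA leq_mul2r.
by apply/orP; right; have := divn_eq j 4; have := ltn_pmod j (isT : 0 < 4)%N; move: (j %/ 4)%N (j %% 4)%N j6 => u v; clear; lia.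
Qed.

Lemma block_le :
  normc (\sum_(Q <= p < 2 * Q | prime p) \sum_(1 <= m < (X %/ p).+1)
     al p * be m * psi (a / (p * m)%:R + b * (p * m)%:R)) <= X%:R / 2 ^+ d.
Proof.
pose D : {pred 'I_(2 * Q)} := [pred u : 'I_(2 * Q) | prime u && (Q <= u)%N].
pose U := {u : 'I_(2 * Q) | u \in D}.
pose p (u : U) : nat := val u.
have pinj : injective p by move=> u v /val_inj /val_inj.
have pp u : prime (p u) by case/andP: (valP u).
have Qp u : (Q <= p u)%N by case/andP: (valP u).
have pX u : (p u < 2 * Q)%N by exact: ltn_ord.
have UQ : (#|{: U}| <= Q)%N.
  rewrite -sum1_card -(big_sub D (fun=> 1%N)) -(@big_geq_mkord _ _ _ Q (2 * Q) prime (fun=> 1%N)).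
  rewrite big_mkcond; apply: leq_trans (_ : \sum_(Q <= i < 2 * Q) 1 <= _)%N.
    by apply: leq_sum => i _; case: ifP.
  by rewrite sum_nat_const_nat muln1 mul2n -addnn addnK.
have big1' : (40 * 4 ^ 8 * t ^ 2 * 2 ^ (2 * n.+1 * e) <= Q)%N by rewrite nE mulnA.
have Bt : (B < 2 ^ t)%N by apply: ltn_trans Bq qt.
have H := @bilinear_le q pq {: U} p a b A B M n t (2 * Q) Q a0 A0 B0 Aq Bq pinj pp pX (ltnW Q_lt_q)
  Q7 MBq Bt UQ e Aqn A4Q qMB big1' A2B (fun u => al (p u)) be X (fun u => al1 _) be1.
set S := \sum_(Q <= p < 2 * Q | prime p) _.
(* As p >= Q, all m <= X / p lie below M = X / Q, so one range of m serves every prime and the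
   condition p m <= X cuts it. *)
have ES : S = \sum_(u : U) \sum_(m < M | (p u * m.+1 <= X)%N)
    al (p u) * be m.+1 * psi (a / (p u * m.+1)%:R + b * (p u * m.+1)%:R).
  rewrite /S big_geq_mkord (big_sub D) /=; apply: eq_bigr => u _.
  have p0 : (0 < p u)%N := prime_gt0 (pp u).
  pose G m := al (p u) * be m.+1 * psi (a / (p u * m.+1)%:R + b * (p u * m.+1)%:R).
  rewrite big_add1 /= big_mkord -[LHS]/(\sum_(m < X %/ p u) G m).
  rewrite (big_ord_widen M G) ?leq_div2l //.
  by apply: eq_bigl => m; rewrite leq_divRL // mulnC.
rewrite -ES in H; have dp : (0 : R) < 2 ^+ d by rewrite exprn_gt0.
rewrite -(@ler_pXn2r _ 4) ?nnegrE ?normc_ge0 ?divr_ge0 ?ler0n ?(ltW dp) //.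
apply: le_trans H _; rewrite expr_div_n -exprM.
apply: ler_pM; rewrite ?addr_ge0 ?divr_ge0 ?exprn_ge0 ?ler0n //.
  by rewrite lerXn2r ?nnegrE ?ler0n // ler_nat mulnC leq_trunc_div.
(* The two error terms 8 k / 2^e and 18 / A each receive half of 2^(-4 d), so the fourth root saves
   2^d. *)
have h2 : (16 * k%:R * 2 ^+ (4 * d) <= 2 ^+ e :> R) by rewrite -!natrX -!natrM ler_nat.
have h3 : (36 * 2 ^+ (4 * d) <= A%:R :> R) by rewrite -!natrX -!natrM ler_nat.
rewrite nE (mulnC d) natrM.
have Dp : (0 : R) < 2 ^+ (4 * d) by rewrite exprn_gt0.
have g2 : 8 * k%:R / 2 ^+ e <= 2^-1 * (2 ^+ (4 * d))^-1 :> R.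
  rewrite ler_pdivrMr ?exprn_gt0 // mulrAC ler_pdivlMr //; lra.
have g3 : 18 / A%:R <= 2^-1 * (2 ^+ (4 * d))^-1 :> R.
  rewrite ler_pdivrMr ?ltr0n // mulrAC ler_pdivlMr //; lra.
lra.
Qed.

End Block.

(** * Sums of reciprocals of primes *)

Section PrimeSums.

Definition lnn (n : nat) : R := ln (n%:R)%R.

Lemma lnn1 : lnn 1 = 0.
Proof. exact: ln_1. Qed.

Lemma lnnM m n : (0 < m)%N -> (0 < n)%N -> lnn (m * n) = lnn m + lnn n.
Proof.
by move=> m0 n0; rewrite /lnn natrM; apply: ln_mult; apply/RltP; rewrite ltr0n.
Qed.

Lemma lnnX m k : (0 < m)%N -> lnn (m ^ k) = k%:R * lnn m.
Proof.
move=> m0; elim: k => [|k IH]; first by rewrite mul0r lnn1.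
by rewrite expnS lnnM ?expn_gt0 ?m0 // IH -[k.+1%:R]natr1 addrC mulrDl mul1r.
Qed.

Lemma lnn_le m n : (0 < m)%N -> (m <= n)%N -> lnn m <= lnn n.
Proof.
move=> m0; rewrite leq_eqVlt => /orP [/eqP ->//|mn]; apply/RleP/Rlt_le/ln_increasing; apply/RltP.
  by rewrite ltr0n.
by rewrite ltr_nat.
Qed.

Lemma lnn_ge0 n : 0 <= lnn n.
Proof.
case: n => [|n]; last by rewrite -lnn1 lnn_le.
by rewrite /lnn /ln; case: Rlt_dec => //= h; case: (Rlt_irrefl 0).
Qed.

Lemma lnn_prod (s : seq nat) (P : pred nat) (F : nat -> nat) : (forall i, P i -> (0 < F i)%N) ->
  lnn (\prod_(i <- s | P i) F i) = \sum_(i <- s | P i) lnn (F i).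
Proof.
move=> F0; suff : lnn (\prod_(i <- s | P i) F i) = \sum_(i <- s | P i) lnn (F i) /\
  (0 < \prod_(i <- s | P i) F i)%N by case.
elim/big_rec2: _ => [|i y x /F0 Fi [<- x0]]; first by rewrite lnn1.
by rewrite lnnM // muln_gt0 Fi x0.
Qed.

Lemma lnn_fact n : lnn n`! = \sum_(0 <= p < n.+1 | prime p) (logn p n`!)%:R * lnn p.
Proof.
have E : n`! = (\prod_(0 <= p < n.+1 | prime p) p ^ logn p n`!)%N.
  rewrite -{1}(partnT (fact_gt0 n)) /partn (@big_cat_nat _ _ _ n.+1) //=; last first.
    by rewrite ltnS; case: n => // n; rewrite factS leq_pmulr ?fact_gt0.
  rewrite [X in (_ * X)%N]big_nat_cond [X in (_ * X)%N]big1 => [|p /andP [/andP [np _] _]].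
    rewrite muln1 big_mkcond [RHS]big_mkcond /=; apply: eq_bigr => p _.
    by case: ifP => // np; rewrite lognE np.
  case pp : (prime p); last by rewrite lognE pp.
  have -> : logn p n`! = 0%N; last by [].
  rewrite logn_fact // big_nat_cond big1 // => i /andP [/andP [i1 _] _].
  by apply: divn_small; apply: leq_trans np _; rewrite -[X in (X <= _)%N]expn1 leq_pexp2l // prime_gt0.
rewrite [in LHS]E lnn_prod => [|p pp]; last by rewrite expn_gt0 prime_gt0.
by apply: eq_bigr => p pp; rewrite lnnX ?prime_gt0.
Qed.

(** Legendre's formula and a geometric series; keeping the remainder n / p^K in the induction makes
    the partial sums telescope. *)
Lemma logn_fact_le p n : prime p -> (p.-1 * logn p n`! <= n)%N.
Proof.
move=> pp; rewrite logn_fact // big_distrr /=.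
suff H K : (\sum_(1 <= k < K.+1) p.-1 * (n %/ p ^ k) + n %/ p ^ K <= n)%N.
  by apply: leq_trans (H n); exact: leq_addr.
elim: K => [|K IH]; first by rewrite big_nil expn0 divn1.
rewrite big_nat_recr //= -addnA -[X in (_ + (_ + X))%N]mul1n -mulnDl addn1 prednK ?prime_gt0 //.
apply: leq_trans IH; rewrite leq_add2l expnSr divnMA mulnC; exact: leq_trunc_div.
Qed.

Lemma logn_fact_ge p n : prime p -> (p <= n)%N -> (n %/ p <= logn p n`!)%N.
Proof.
move=> pp pn; rewrite logn_fact // big_nat_recl ?expn1 ?leq_addr //.
by apply: leq_trans pn; rewrite prime_gt0.
Qed.

Lemma fact_le_expn n : (n`! <= n ^ n)%N.
Proof.
rewrite fact_prod -[X in (_ <= _ ^ X)%N](subn1 n.+1) -prod_nat_const_nat.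
rewrite big_nat [leqRHS]big_nat; apply: leq_prod => i /andP [_ h]; exact: h.
Qed.

(** The upper half of Mertens' estimate: compare ln n! <= n ln n with logn p n! >= n / (2 p) for p
    <= n. *)
Lemma sum_lnn_prime_le n : (0 < n)%N ->
  \sum_(0 <= p < n.+1 | prime p) lnn p / p%:R <= 2 * lnn n.
Proof.
move=> n0; have np : (0 : R) < n%:R by rewrite ltr0n.
have h1 : lnn n`! <= n%:R * lnn n.
  by rewrite -lnnX // lnn_le ?fact_gt0 ?fact_le_expn.
have h2 : n%:R / 2 * (\sum_(0 <= p < n.+1 | prime p) lnn p / p%:R) <= lnn n`!.
  rewrite lnn_fact mulr_sumr big_nat_cond [leRHS]big_nat_cond; apply: ler_sum => p.
  move=> /andP [/andP [_ pn] pp]; rewrite ltnS in pn.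
  have p0 : (0 : R) < p%:R by rewrite ltr0n prime_gt0.
  rewrite mulrCA [leRHS]mulrC ler_wpM2l ?lnn_ge0 //.
  apply: le_trans (_ : (n %/ p)%:R <= _); last by rewrite ler_nat logn_fact_ge.
  rewrite ler_pdivrMr // ler_pdivrMr ?ltr0n // -!natrM ler_nat.
  have := ltn_ceil n (prime_gt0 pp); have : (0 < n %/ p)%N by rewrite divn_gt0 ?prime_gt0.
  set z := (_ %/ _)%N => z0 /ltnW h; apply: leq_trans h _.
  by rewrite -mulnA [(p * 2)%N]mulnC mulnA leq_mul2r muln2 -addnn -addn1 leq_add2l z0 orbT.
have h3 := le_trans h2 h1.
by rewrite -(ler_pM2l np); lra.
Qed.

Lemma lnn_fact_ge n : n%:R * lnn n - n%:R <= lnn n`!.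
Proof.
elim: n => [|n IH]; first by rewrite mul0r subr0 lnn_ge0.
rewrite factS lnnM ?fact_gt0 //.
case: n IH => [|n] IH; first by rewrite fact0 !lnn1; lra.
set m := n.+1 in IH *.
have m0 : (0 : R) < m%:R by rewrite ltr0n.
(* This is m ln(1 + 1/m) <= 1, from 1 + x <= exp x. *)
have : m%:R * (lnn m.+1 - lnn m) <= 1.
  have -> : lnn m.+1 - lnn m = ln (1 + m%:R^-1)%R.
    have := @ln_mult m%:R%R (1 + m%:R^-1)%R; rewrite RmultE RplusE.
    have -> : (m%:R * (1 + m%:R^-1) = m.+1%:R :> R)%R by rewrite mulrDr mulfV ?gt_eqF // mulr1 natr1.
    rewrite -/(lnn m) -/(lnn m.+1) => ->; first by rewrite addrC addKr.
      exact/RltP.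
    by apply/RltP; rewrite addr_gt0 // invr_gt0.
  rewrite -ler_pdivlMl // mulr1; apply/RleP; rewrite -[X in Rle _ X]ln_exp.
  have e1 : 1 + m%:R^-1 <= exp (m%:R^-1)%R.
    by apply/RleP/Rlt_le/exp_ineq1; apply/eqP; rewrite invr_eq0 gt_eqF.
  move: e1; rewrite le_eqVlt => /orP [/eqP ->|e1]; first exact: Rle_refl.
  by apply/Rlt_le/ln_increasing; apply/RltP => //; rewrite addr_gt0 ?invr_gt0.
rewrite -[m.+1%:R]natr1 mulrBr mulrDl mul1r; lra.
Qed.

Lemma sum_lnn_prime_ge n : (0 < n)%N ->
  lnn n - 1 <= 2 * \sum_(0 <= p < n.+1 | prime p) lnn p / p%:R.
Proof.
move=> n0; have np : (0 : R) < n%:R by rewrite ltr0n.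
rewrite -(ler_pM2l np) mulrBr mulr1; apply: le_trans (lnn_fact_ge n) _.
rewrite lnn_fact !mulr_sumr; apply: ler_sum => p pp.
have p0 : (0 : R) < p%:R by rewrite ltr0n prime_gt0.
rewrite mulrC !mulrA [leRHS]mulrAC [leRHS]mulrC ler_wpM2l ?lnn_ge0 //.
rewrite ler_pdivlMr // -!natrM ler_nat.
have := logn_fact_le n pp; have := prime_gt1 pp; case: p {p0 pp} => [|[|p]] //= _ h.
apply: leq_trans (_ : 2 * (p.+1 * logn p.+2 n`!) <= _)%N; last by rewrite [leqRHS]mulnC leq_mul2l h.
by rewrite mulnC mulnA leq_mul2r; apply/orP; right; lia.
Qed.

(* Compares [ln N`!] and [ln (N ^ 5)`!] through [n / (2 p) <= logn p n`! <= 2 n / p]. *)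
Lemma sum_prime_window N : (16 <= N)%N ->
  1 / 20 <= \sum_(N <= p < N ^ 5 | prime p) (p%:R : R)^-1.
Proof.
move=> N16; have N0 : (0 < N)%N by apply: leq_trans N16.
have N50 : (0 < N ^ 5)%N by rewrite expn_gt0 N0.
have lnN : 2 <= lnn N.
  apply: le_trans (lnn_le _ N16) => //.
  rewrite (_ : 16 = 2 ^ 4)%N // lnnX //.
  have := ln_lt_2; move=> /RltP; rewrite -[ln 2]/(lnn 2) => h.
  have h2 : 2^-1 < lnn 2 :> R by exact: h.
  lra.
have up := sum_lnn_prime_le N0.
have lo := sum_lnn_prime_ge N50.
rewrite lnnX // in lo.
rewrite (@big_cat_nat _ _ _ N.+1) //= in lo; last first.
  by rewrite ltnS -{1}[N]expn1 leq_pexp2l.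
set S1 := \sum_(0 <= i < N.+1 | prime i) _ in up lo.
set S2 := \sum_(N.+1 <= i < (N ^ 5).+1 | prime i) _ in lo.
set T := \sum_(N <= p < _ | prime p) _.
have S2T : S2 <= 5 * lnn N * T.
  rewrite /S2 big_mkcond big_nat_recr /=; last by rewrite -{1}[N]expn1 ltn_exp2l //; apply: leq_trans N16.
  (* [S2] includes the endpoint N^5 and [T] does not; being composite it contributes nothing. *)
  have -> : prime (N ^ 5) = false.
    apply/negP => /primeP [_ /(_ N)]; rewrite expnS dvdn_mulr // => /(_ isT).
    rewrite -expnS => /orP [/eqP N1|/eqP NE]; first by rewrite N1 in N16.
    have : (N ^ 1 < N ^ 5)%N by rewrite ltn_exp2l //; apply: leq_trans N16.
    by rewrite expn1 {1}NE ltnn.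
  rewrite addr0 -big_mkcond /T (@big_cat_nat _ _ _ N.+1 N) //=; last first.
    by rewrite -{1}[N]expn1 ltn_exp2l //; apply: leq_trans N16.
  rewrite mulrDr; apply: ler_wpDl.
    apply: mulr_ge0; first by lra.
    by apply: sumr_ge0 => i _; rewrite invr_ge0 ler0n.
  rewrite mulr_sumr big_nat_cond [leRHS]big_nat_cond; apply: ler_sum => p.
  move=> /andP [/andP [_ pN] pp].
  rewrite ler_wpM2r ?invr_ge0 ?ler0n // -lnnX // lnn_le ?prime_gt0 //.
  by move: pN; lia.
(* The two estimates give S2 >= (5 ln N - 1) / 2 - 2 ln N = (ln N - 1) / 2 >= (ln N) / 4, using ln N
   >= 2; dividing by 5 ln N yields 1/20. *)
have lp : 0 < lnn N by lra.
suff : lnn N * (1 / 20) <= lnn N * T by rewrite ler_pM2l.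
lra.
Qed.

Lemma sum_prime_windows j w : (4 <= j)%N ->
  w%:R / 20 <= \sum_(2 ^ j <= p < 2 ^ (j * 5 ^ w) | prime p) (p%:R : R)^-1.
Proof.
move=> j4; elim: w => [|w IH]; first by rewrite mul0r muln1 big_geq.
rewrite (big_cat_nat (n := 2 ^ (j * 5 ^ w))) /=; first last.
- by rewrite leq_exp2l // leq_mul2l leq_exp2l // leqnSn orbT.
- by rewrite leq_exp2l // leq_pmulr // expn_gt0.
rewrite -[w.+1%:R]natr1 mulrDl; apply: lerD => //.
have -> : (2 ^ (j * 5 ^ w.+1) = (2 ^ (j * 5 ^ w)) ^ 5)%N by rewrite -expnM expnSr mulnA.
apply: sum_prime_window; rewrite (_ : 16 = 2 ^ 4)%N // leq_exp2l //.
by apply: leq_trans j4 _; rewrite leq_pmulr // expn_gt0.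
Qed.

End PrimeSums.

(** * Turan-Kubilius inequality *)

Lemma sum_multiples (V : zmodType) (F : nat -> V) (p X : nat) : (0 < p)%N ->
  \sum_(1 <= n < X.+1 | (p %| n)%N) F n = \sum_(1 <= m < (X %/ p).+1) F (p * m)%N.
Proof.
move=> p0; elim: X => [|X IH]; first by rewrite div0n !big_geq.
rewrite big_mkcond big_nat_recr //= -big_mkcond IH.
case: (boolP (p %| X.+1)%N) => dv; last by rewrite divnS // (negbTE dv) addr0.
have E : (X.+1 %/ p = (X %/ p).+1)%N by rewrite divnS // dv.
by rewrite E [RHS]big_nat_recr //= -E mulnC divnK.
Qed.

Section TuranKubilius.
Variables (X P0 P1 : nat).

Definition prime_recip_sum : R := \sum_(P0 <= p < P1 | prime p) (p%:R)^-1.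
Definition omega (n : nat) : R := \sum_(P0 <= p < P1 | prime p) (p %| n)%N%:R.
Local Notation L := prime_recip_sum.

Lemma prime_recip_sum_ge0 : 0 <= L.
Proof. by apply: sumr_ge0 => p _; rewrite invr_ge0 ler0n. Qed.

Lemma divn_le_div n d : (n %/ d)%:R <= n%:R / d%:R :> R.
Proof.
case: (posnP d) => [->|d0]; first by rewrite divn0 invr0 mulr0.
by rewrite ler_pdivlMr ?ltr0n // -natrM ler_nat leq_trunc_div.
Qed.

Lemma div_le_divn n d : (0 < d)%N -> n%:R / d%:R <= (n %/ d)%:R + 1 :> R.
Proof.
move=> d0; rewrite ler_pdivrMr ?ltr0n // natr1 -natrM ler_nat.
exact: ltnW (ltn_ceil n d0).
Qed.

(** Expand the square. The first moment of [omega] is at least X L - P1, each prime losing at most 1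
    by rounding. In the second moment distinct primes are coprime and give at most X L^2, and the
    diagonal adds X L. *)
Lemma turan_kubilius :
  \sum_(1 <= n < X.+1) (L - omega n) ^+ 2 <= X%:R * L + 2 * L * P1%:R.
Proof.
have L0 := prime_recip_sum_ge0.
have sum1 : X%:R * L - P1%:R <= \sum_(1 <= n < X.+1) omega n.
  rewrite /omega exchange_big /=.
  apply: le_trans (_ : \sum_(P0 <= p < P1 | prime p) (X%:R / p%:R - 1) <= _); last first.
    apply: ler_sum => p pp; rewrite -natr_sum -divn_count_dvd lerBlDr.
    exact/div_le_divn/prime_gt0.
  rewrite sumrB -mulr_sumr lerB // big_mkcond.
  apply: le_trans (_ : \sum_(P0 <= p < P1) 1 <= _).
    by apply: ler_sum => p _; case: ifP.
  by rewrite sumr_const_nat ler_nat leq_subr.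
have sum2 : \sum_(1 <= n < X.+1) omega n ^+ 2 <= X%:R * L ^+ 2 + X%:R * L.
  have -> : \sum_(1 <= n < X.+1) omega n ^+ 2 = \sum_(P0 <= p < P1 | prime p)
     \sum_(P0 <= p' < P1 | prime p') \sum_(1 <= n < X.+1) ((p %| n) && (p' %| n))%N%:R.
    under eq_bigr => n _ do rewrite expr2 /omega mulr_suml.
    rewrite exchange_big /=; apply: eq_bigr => p _.
    under eq_bigr => n _ do rewrite mulr_sumr.
    rewrite exchange_big /=; apply: eq_bigr => p' _.
    by apply: eq_bigr => n _; rewrite -natrM mulnb.
  have -> : X%:R * L ^+ 2 + X%:R * L = \sum_(P0 <= p < P1 | prime p)
     (\sum_(P0 <= p' < P1 | prime p') (X%:R / p%:R / p'%:R) + X%:R / p%:R).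
    rewrite big_split /= -[in X in _ = _ + X]mulr_sumr; congr (_ + _).
    rewrite (eq_bigr (fun p => X%:R / p%:R * L)) => [|p _]; last by rewrite mulr_sumr.
    by rewrite -mulr_suml -mulr_sumr expr2 mulrA.
  rewrite big_nat_cond [leRHS]big_nat_cond; apply: ler_sum => p /andP [/andP [Pp pP] pp].
  rewrite (big_rem p) /= ?mem_index_iota ?Pp ?pP // pp.
  rewrite [X in _ <= X + _](big_rem p) /= ?mem_index_iota ?Pp ?pP // pp.
  have p0 : (0 : R) <= p%:R^-1 by rewrite invr_ge0 ler0n.
  have d1 : \sum_(1 <= n < X.+1) ((p %| n) && (p %| n))%N%:R <= X%:R / p%:R :> R.
    under eq_bigr do rewrite andbb.
    by rewrite -natr_sum -divn_count_dvd divn_le_div.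
  have d2 : 0 <= X%:R / p%:R / p%:R :> R by rewrite !mulr_ge0 ?ler0n.
  suff : \sum_(y <- rem p (index_iota P0 P1) | prime y) \sum_(1 <= n < X.+1) ((p %| n) && (y %| n))%N%:R
     <= \sum_(y <- rem p (index_iota P0 P1) | prime y) X%:R / p%:R / y%:R :> R by lra.
  rewrite big_seq_cond [leRHS]big_seq_cond; apply: ler_sum => y /andP [yr py].
  have yp : y != p by move: yr; rewrite mem_rem_uniq ?iota_uniq // inE => /andP [].
  have co : coprime p y by rewrite prime_coprime // dvdn_prime2 // eq_sym.
  under eq_bigr => n _ do rewrite -Gauss_dvd //.
  by rewrite -natr_sum -divn_count_dvd -mulrA -invfM -natrM divn_le_div.
have -> : \sum_(1 <= n < X.+1) (L - omega n) ^+ 2 =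
    X%:R * L ^+ 2 - 2 * L * \sum_(1 <= n < X.+1) omega n + \sum_(1 <= n < X.+1) omega n ^+ 2.
  have -> : X%:R * L ^+ 2 = \sum_(1 <= n < X.+1) L ^+ 2.
    by rewrite sumr_const_nat subn1 /= mulr_natl.
  rewrite mulr_sumr -sumrB -big_split /=; apply: eq_bigr => n _; ring.
have : 2 * L * (X%:R * L - P1%:R) <= 2 * L * \sum_(1 <= n < X.+1) omega n.
  by rewrite ler_wpM2l // mulr_ge0.
rewrite expr2 in sum2 *; lra.
Qed.

Lemma turan_kubilius_sum (F : nat -> R[i]) : (forall n, normc (F n) <= 1) ->
  normc (\sum_(1 <= n < X.+1) F n * (L - omega n)%:C) ^+ 2 <= X%:R * (X%:R * L + 2 * L * P1%:R).
Proof.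
move=> F1.
apply: le_trans (_ : (\sum_(n < X) `|L - omega n.+1|) ^+ 2 <= _).
  rewrite lerXn2r ?nnegrE ?normc_ge0 ?sumr_ge0 // big_add1 big_mkord /=.
  apply: le_trans (ler_normc_sum _ _ _) _; apply: ler_sum => n _.
  rewrite normcM -[leRHS]mul1r.
  have -> : normc (L - omega n.+1)%:C = `|L - omega n.+1|.
    by rewrite /= expr0n /= addr0 sqrtr_sqr.
  by rewrite ler_wpM2r.
apply: le_trans (power_mean 1 (fun n => normr_ge0 _)) _.
rewrite card_ord expr1 ler_wpM2l //.
apply: le_trans turan_kubilius; rewrite big_add1 big_mkord /=.
by apply: ler_sum => n _; rewrite real_normK ?num_real.
Qed.

End TuranKubilius.

(** * From a multiplicative sum to bilinear sums over primes *)

Section Katai.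
Variables (q : nat) (pq : prime q) (a b : 'F_q) (X : nat) (f : nat -> R[i]).
Hypothesis f1 : forall n, normc (f n) <= 1.
Hypothesis fM : forall m n, coprime m n -> f (m * n)%N = f m * f n.
Variables (j0 j1 : nat) (c : R).
Local Notation ph n := (psi (a / n%:R + b * n%:R)).
Local Notation L := (prime_recip_sum (2 ^ j0) (2 ^ j1)).
Hypothesis block : forall j, (j0 <= j < j1)%N ->
  normc (\sum_(2 ^ j <= p < 2 * 2 ^ j | prime p) \sum_(1 <= m < (X %/ p).+1)
     f p * f m * ph (p * m)%N) <= c.

Lemma dyadic_blocks : (j0 <= j1)%N ->
  normc (\sum_(2 ^ j0 <= p < 2 ^ j1 | prime p) \sum_(1 <= m < (X %/ p).+1)
     f p * f m * ph (p * m)%N) <= (j1 - j0)%:R * c.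
Proof.
move=> j01; suff H i : (j0 + i <= j1)%N -> normc (\sum_(2 ^ j0 <= p < 2 ^ (j0 + i) | prime p)
    \sum_(1 <= m < (X %/ p).+1) f p * f m * ph (p * m)%N) <= i%:R * c.
  by have := H (j1 - j0)%N; rewrite subnKC //; apply.
elim: i => [|i IH] ij; first by rewrite addn0 big_geq // normc0 mul0r.
rewrite addnS in ij *.
rewrite (@big_cat_nat _ _ _ (2 ^ (j0 + i))) /= ?leq_exp2l ?leq_addr //.
apply: le_trans (le_normcD _ _) _; rewrite -natr1 mulrDl mul1r lerD ?IH ?(ltnW ij) //.
by rewrite expnS; apply: block; rewrite leq_addr.
Qed.

(** Replace the weight L by [omega] (Turan-Kubilius), then write n = p m. Multiplicativity fails to
    split f(p m) only if p divides m, which happens for at most X / p^2 values of m, each costing 2;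
    as p >= 2^j0 this is the middle term. *)
Lemma katai : (j0 <= j1)%N ->
  L * normc (\sum_(1 <= n < X.+1) f n * ph n) <=
  Num.sqrt (X%:R * (X%:R * L + 2 * L * (2 ^ j1)%:R)) + 2 * X%:R * L / (2 ^ j0)%:R + (j1 - j0)%:R * c.
Proof.
move=> j01; set S := \sum_(_ <= n < _) _; have L0 := prime_recip_sum_ge0 (2 ^ j0) (2 ^ j1).
pose F n := f n * ph n.
have F1 n : normc (F n) <= 1 by rewrite normcM normc_psi mulr1.
pose D := \sum_(2 ^ j0 <= p < 2 ^ j1 | prime p) \sum_(1 <= m < (X %/ p).+1)
     f p * f m * ph (p * m)%N.
pose E := \sum_(2 ^ j0 <= p < 2 ^ j1 | prime p) \sum_(1 <= m < (X %/ p).+1)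
     (F (p * m)%N - f p * f m * ph (p * m)%N).
have dec : L%:C * S = \sum_(1 <= n < X.+1) F n * (L - omega (2 ^ j0) (2 ^ j1) n)%:C + E + D.
  rewrite -addrA; have -> : E + D = \sum_(1 <= n < X.+1) F n * (omega (2 ^ j0) (2 ^ j1) n)%:C.
    rewrite /E /D -big_split /=.
    under [RHS]eq_bigr => n _ do rewrite rmorph_sum mulr_sumr.
    rewrite [RHS]exchange_big /=; apply: eq_bigr => p pp.
    rewrite -big_split /= (eq_bigr (fun m => F (p * m)%N)) => [|m _]; last by rewrite subrK.
    rewrite -sum_multiples ?prime_gt0 // big_mkcond; apply: eq_bigr => n _.
    by case: ifP => _; rewrite ?rmorph1 ?rmorph0 ?mulr1 ?mulr0.
  rewrite -big_split /= mulr_sumr; apply: eq_bigr => n _.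
  by rewrite -mulrDr -rmorphD /= subrK mulrC.
have -> : L * normc S = normc (L%:C * S).
  by rewrite normcM; congr (_ * _); rewrite /= expr0n /= addr0 sqrtr_sqr ger0_norm.
rewrite dec; apply: le_trans (le_normcD _ _) _; apply: lerD; last exact: dyadic_blocks.
apply: le_trans (le_normcD _ _) _; apply: lerD.
  rewrite -[leLHS]ger0_norm ?normc_ge0 // -sqrtr_sqr ler_wsqrtr //.
  exact: turan_kubilius_sum.
apply: le_trans (ler_normc_sum _ _ _) _.
rewrite /prime_recip_sum mulr_sumr mulr_suml big_nat_cond [leRHS]big_nat_cond.
apply: ler_sum => p /andP [/andP [Pp _] pp].
apply: le_trans (ler_normc_sum _ _ _) _.
apply: le_trans (_ : \sum_(1 <= m < (X %/ p).+1) 2 * (p %| m)%N%:R <= _).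
  apply: ler_sum => m _; rewrite /F -mulrBl normcM normc_psi mulr1.
  case: (boolP (p %| m)%N) => pm.
    apply: le_trans (le_normcD _ _) _; rewrite normcN normcM mulr1 (_ : 2 = 1 + 1 :> R) //.
    by apply: lerD => //; apply: mulr_ile1; rewrite ?normc_ge0.
  by rewrite fM ?subrr ?normc0 ?mulr0 // prime_coprime.
rewrite -mulr_sumr -natr_sum -divn_count_dvd -!mulrA ler_wpM2l //.
apply: le_trans (divn_le_div _ _) _; rewrite mulrA.
apply: ler_pM; rewrite ?invr_ge0 ?ler0n ?divn_le_div //.
by rewrite lef_pV2 ?posrE ?ltr0n ?expn_gt0 ?prime_gt0 // ler_nat.
Qed.

End Katai.

(** * Choice of scales *)

(** Both r^2 and 146 s + 86 are at most sqrt t. *)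
Lemma scale_lower (r s t : nat) : (0 < r)%N -> (r ^ 4 <= t)%N -> ((146 * s + 86) ^ 2 <= t)%N ->
  ((146 * s + 86) * r <= t %/ r)%N.
Proof.
move=> r0 rt st; rewrite leq_divRL //.
rewrite -(@leq_exp2r _ _ 2) // -mulnA mulnn expnMn -expnM mulnC.
by rewrite -[leqRHS]mulnn leq_mul.
Qed.

Lemma expn_const_le : (40 * 4 ^ 8 <= 2 ^ 22)%N.
Proof.
have H m : (40 * (2 ^ 2) ^ m <= 2 ^ (6 + 2 * m))%N by rewrite -expnM expnD leq_mul2r orbT.
exact: (H 8).
Qed.

Section Scales.
Variables (q t s w : nat).
Hypotheses (qt : (q < 2 ^ t)%N) (tq : (2 ^ t <= 2 * q)%N) (ts : (t <= 2 ^ s)%N).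
Hypotheses (wt : ((16 * 5 ^ w) ^ 4 <= t)%N) (st : ((146 * s + 86) ^ 2 <= t)%N).

(* The exponents from [scale_min] to [scale_max] form [w] windows [i, 5 i), each of which
   contributes at least [1 / 20] to the sum of reciprocals of primes. *)
Definition scale_base := (16 * 5 ^ w)%N.
Definition scale_min := (t %/ scale_base).+1.
Definition scale_max := (scale_min * 5 ^ w)%N.

Lemma scale_base_gt0 : (0 < scale_base)%N. Proof. by rewrite muln_gt0 expn_gt0. Qed.

Lemma scale_base_le : (scale_base <= t)%N.
Proof. by apply: leq_trans wt; rewrite -[X in (X <= _)%N]expn1 leq_pexp2l // scale_base_gt0. Qed.

Lemma scale_min_ge : ((146 * s + 86) * scale_base < scale_min)%N.
Proof. by rewrite ltnS; apply: scale_lower => //; exact: scale_base_gt0. Qed.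

Lemma scale_min_le_max : (scale_min <= scale_max)%N.
Proof. by rewrite leq_pmulr // expn_gt0. Qed.

(** The factor 16 in [scale_base] puts the top exponent near t / 16; rounding [scale_min] up costs
    at most another factor 2. *)
Lemma scale_max_le : (8 * scale_max <= t)%N.
Proof.
have h : (scale_min * scale_base <= 2 * t)%N.
  rewrite /scale_min mulSn mul2n -addnn leq_add ?scale_base_le //; exact: leq_trunc_div.
rewrite -(leq_pmul2l (ltn0Sn 1)); apply: leq_trans h; rewrite /scale_max /scale_base.
by rewrite mulnCA mulnA mulnCA.
Qed.

Lemma scale_min_ge86 : (86 < scale_min)%N.
Proof.
apply: leq_ltn_trans scale_min_ge; rewrite -[X in (X <= _)%N]muln1 leq_mul ?scale_base_gt0 // leq_addl //.
Qed.

Lemma scale_pow j : (scale_min <= j)%N -> (q <= 2 ^ (j * scale_base))%N.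
Proof.
move=> jj; apply: leq_trans (ltnW qt) _; rewrite leq_exp2l //.
apply: ltnW; apply: leq_trans (ltn_ceil t scale_base_gt0) _.
by rewrite leq_mul2r jj orbT.
Qed.

Lemma scale_upper j : (j < scale_max)%N -> (2 ^ (7 * j + 11) <= q)%N.
Proof.
move=> jj; rewrite -(leq_pmul2l (ltn0Sn 1)) -expnS; apply: leq_trans tq.
rewrite leq_exp2l //; have := scale_max_le; have := scale_min_ge86; have := scale_min_le_max.
move: jj; move: scale_min scale_max => u v; clear; lia.
Qed.

(** The origin of 146 s + 86: the exponent 16 (9 s + 4) gives 144 s + 64, and the constant 2^22 with
    t^2 <= 2^(2 s) adds 22 + 2 s. *)
Lemma scale_big1 j : (scale_min <= j)%N ->
  (40 * 4 ^ 8 * t ^ 2 * 2 ^ (16 * scale_base * (9 * s + 4)) <= 2 ^ j)%N.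
Proof.
move=> jj; apply: leq_trans (_ : 2 ^ 22 * 2 ^ (s * 2) * 2 ^ (16 * scale_base * (9 * s + 4)) <= _)%N.
  by rewrite leq_mul2r leq_mul ?expn_const_le ?orbT // expnM leq_exp2r.
rewrite -!expnD leq_exp2l //; apply: leq_trans jj; apply: ltnW; apply: leq_ltn_trans scale_min_ge.
have := scale_base_gt0; move: scale_base => [//|r] _.
rewrite -[X in (X + _ <= _)%N]muln1; apply: leq_trans (_ : (22 + s * 2) * r.+1 + 16 * r.+1 * (9 * s + 4) <= _)%N.
  by rewrite leq_add2r leq_mul2l orbT.
by rewrite [(16 * _)%N]mulnC -mulnA [X in (X + _ <= _)%N]mulnC -mulnDr mulnC leq_mul2r; apply/orP; right; clear; lia.
Qed.

(** The origin of e = 9 s + 4 with saving exponent d = 2 s: the three factors are at most 2^4, 2^s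
    and 2^(8 s). *)
Lemma scale_big2 : (16 * scale_base * 2 ^ (4 * (2 * s)) <= 2 ^ (9 * s + 4))%N.
Proof.
rewrite (_ : 9 * s + 4 = 4 + s + 4 * (2 * s))%N; last by clear; lia.
rewrite !expnD leq_mul2r leq_mul2l; apply/orP; right; apply/orP; right.
exact: leq_trans scale_base_le ts.
Qed.

Lemma scale_big3 j : (scale_min <= j)%N -> (36 * 2 ^ (4 * (2 * s)) <= 2 ^ (j %/ 4))%N.
Proof.
move=> jj; apply: leq_trans (_ : 2 ^ 6 * 2 ^ (4 * (2 * s)) <= _)%N; first by rewrite leq_mul2r orbT.
rewrite -expnD leq_exp2l // leq_divRL //.
apply: leq_trans jj; apply: ltnW; apply: leq_ltn_trans scale_min_ge.
apply: leq_trans (leq_pmulr _ scale_base_gt0); clear; lia.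
Qed.

End Scales.

(** * The bound for one modulus, in terms of the number w of windows *)

Section Assembly.
Variables (q : nat) (pq : prime q) (a b : 'F_q) (X t s w : nat) (f : nat -> R[i]).
Hypotheses (a0 : a != 0) (f1 : forall n, normc (f n) <= 1).
Hypothesis fM : forall m n, coprime m n -> f (m * n)%N = f m * f n.
Hypotheses (Xq : (X <= q)%N) (qX : (q <= X ^ 2)%N).
Hypotheses (qt : (q < 2 ^ t)%N) (tq : (2 ^ t <= 2 * q)%N) (ts : (t <= 2 ^ s)%N).
Hypotheses (w0 : (0 < w)%N) (wt : ((16 * 5 ^ w) ^ 4 <= t)%N) (st : ((146 * s + 86) ^ 2 <= t)%N).

(** After multiplication by sqrt(w / 20) <= sqrt L and division by L, the Turan-Kubilius error, the
    failure of complete multiplicativity and the bilinear sums contribute at most 3/2 X, 2 X and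
    X. *)
Lemma kloosterman_mult_le :
  normc (\sum_(1 <= n < X.+1) f n * psi (a / n%:R + b * n%:R)) * Num.sqrt (w%:R / 20) <= 5 * X%:R.
Proof.
set S := \sum_(_ <= n < _) _.
set j0 := scale_min t w; set j1 := scale_max t w.
pose L := prime_recip_sum (2 ^ j0) (2 ^ j1).
have bl j : (j0 <= j < j1)%N ->
  normc (\sum_(2 ^ j <= p < 2 * 2 ^ j | prime p) \sum_(1 <= m < (X %/ p).+1)
     f p * f m * psi (a / (p * m)%N%:R + b * (p * m)%N%:R)) <= X%:R / 2 ^+ (2 * s).
  move=> /andP [jl jh]; apply: (@block_le q pq a b X (scale_base w) j (9 * s + 4) (2 * s) t) => //.
  - exact: scale_base_gt0.
  - by apply: leq_trans jl; apply: leq_trans (scale_min_ge86 wt st).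
  - exact: scale_pow jl.
  - exact: (scale_upper tq wt st jh).
  - exact: (scale_big1 ts wt st jl).
  - exact: (scale_big2 ts wt).
  - exact: (scale_big3 wt st jl).
have := katai f1 fM bl (scale_min_le_max _ _).
rewrite -/S -/j0 -/j1 -/L => H.
have L_ge : w%:R / 20 <= L.
  by apply: sum_prime_windows; apply: leq_trans (scale_min_ge86 wt st).
have wp : (0 : R) < w%:R / 20 by rewrite divr_gt0 // ltr0n.
have L0 : 0 < L by apply: lt_le_trans L_ge.
set sg := Num.sqrt (w%:R / 20); set la := Num.sqrt L.
have sg0 : 0 < sg by rewrite sqrtr_gt0.
have la0 : 0 < la by rewrite sqrtr_gt0.
have sgE : sg ^+ 2 = w%:R / 20 by rewrite sqr_sqrtr // ltW.
have laE : la ^+ 2 = L by rewrite sqr_sqrtr // ltW.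
have sl : sg <= la by exact: ler_wsqrtr.
have j8 := scale_max_le wt.
have j1p : (1 < j1)%N.
  apply: leq_trans (scale_min_le_max t w); apply: leq_trans (scale_min_ge86 wt st) => //.
have X2 : (2 * 2 ^ j1 <= X)%N.
  rewrite -(@leq_exp2r _ _ 2) //; apply: leq_trans qX.
  rewrite -(leq_pmul2l (ltn0Sn 1)); apply: leq_trans tq.
  rewrite -!expnS -expnM -expnS leq_exp2l //.
  by move: j8 j1p; rewrite -/j1; move: (j1) => v; clear; lia.
have t0 : (1 <= t)%N by apply: leq_trans (scale_base_le wt); exact: scale_base_gt0.
have jt : (j1 - j0 <= t)%N.
  by apply: leq_trans (leq_subr _ _) _; apply: leq_trans j8; exact: leq_pmull.
have X0 : (0 : R) <= X%:R by rewrite ler0n.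
have tp0 : (0 : R) < t%:R by rewrite ltr0n.
(* As 2 * 2^j1 <= X, the radicand is at most 2 X^2 L, and sqrt 2 <= 3/2. *)
have b1 : Num.sqrt (X%:R * (X%:R * L + 2 * L * (2 ^ j1)%:R)) <= 3 / 2 * (X%:R * la).
  apply: le_trans (_ : Num.sqrt ((3 / 2 * (X%:R * la)) ^+ 2) <= _); last first.
    have h : 0 <= 3 / 2 * (X%:R * la) by rewrite mulr_ge0 ?divr_ge0 // mulr_ge0 // ltW.
    by rewrite sqrtr_sqr ger0_norm.
  rewrite ler_wsqrtr // exprMn [(X%:R * la) ^+ 2]exprMn laE.
  have h : 2 * (2 ^ j1)%:R <= X%:R :> R by rewrite -natrM ler_nat.
  have XL : 0 <= X%:R * L by rewrite mulr_ge0 // ltW.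
  have := ler_wpM2l XL h; have := mulr_ge0 X0 XL; rewrite !expr2; lra.
have b2 : 2 * X%:R * L / (2 ^ j0)%:R <= 2 * X%:R * L / sg.
  rewrite ler_wpM2l ?mulr_ge0 ?(ltW L0) // lef_pV2 ?posrE ?ltr0n ?expn_gt0 //.
  rewrite -(@ler_pXn2r _ 2) ?nnegrE ?ler0n ?(ltW sg0) // sgE.
  apply: le_trans (_ : w%:R <= _); first by rewrite ler_pdivrMr // ler_peMr ?ler0n // ler1n.
  rewrite -natrX ler_nat -expnM.
  apply: leq_trans (ltnW (ltn_expl w (isT : 1 < 5)%N)) _.
  apply: leq_trans (_ : scale_base w <= _)%N; first exact: leq_pmull.
  apply: leq_trans (_ : j0 <= _)%N.
    apply: ltnW; apply: leq_ltn_trans (scale_min_ge wt st); apply: leq_pmull.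
    by rewrite addn_gt0 orbT.
  apply: leq_trans (ltnW (ltn_expl j0 (isT : 1 < 2)%N)) _.
  by rewrite leq_exp2l // leq_pmulr.
(* At most t blocks, each saving 2^(2 s) >= t^2. *)
have b3 : (j1 - j0)%:R * (X%:R / 2 ^+ (2 * s)) <= X%:R / t%:R :> R.
  rewrite mulrCA ler_wpM2l // ler_pdivrMr ?exprn_gt0 // [leRHS]mulrC ler_pdivlMr //.
  rewrite -natrX -natrM ler_nat mul2n -addnn expnD leq_mul //.
  exact: leq_trans jt ts.
have tsg : 1 <= t%:R * sg.
  rewrite -(@ler_pXn2r _ 2) ?nnegrE ?mulr_ge0 ?(ltW sg0) ?ler0n // expr1n exprMn sgE.
  rewrite mulrA ler_pdivlMr // mul1r -natrX -natrM ler_nat.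
  apply: leq_trans (_ : t <= _)%N; last first.
    by rewrite -mulnn -mulnA leq_pmulr // muln_gt0 t0.
  apply: leq_trans (scale_base_le wt); rewrite /scale_base; apply: leq_trans (_ : 16 * 5 ^ 1 <= _)%N => //.
  by rewrite leq_mul2l leq_exp2l.
have H' : L * normc S <= 3 / 2 * (X%:R * la) + 2 * X%:R * L / sg + X%:R / t%:R.
  by apply: le_trans H _; apply: lerD => //; apply: lerD.
rewrite -(ler_pM2l L0) mulrA.
apply: le_trans (_ : (3 / 2 * (X%:R * la) + 2 * X%:R * L / sg + X%:R / t%:R) * sg <= _).
  by rewrite ler_wpM2r // ltW.
rewrite [leLHS]mulrDl [X in X + _ <= _]mulrDl mulfVK ?gt_eqF //.
have c1 : 3 / 2 * (X%:R * la) * sg <= 3 / 2 * X%:R * L.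
  rewrite -laE expr2 !mulrA ler_wpM2l //.
  by apply: mulr_ge0; [rewrite mulr_ge0 ?divr_ge0 | exact: ltW].
have c2 : X%:R / t%:R * sg <= X%:R * L.
  rewrite -mulrA ler_wpM2l // ler_pdivrMl //.
  apply: le_trans (_ : t%:R * (sg * sg) <= _); last by rewrite ler_wpM2l ?ler0n // -expr2 sgE.
  by rewrite mulrA ler_peMl // ltW.
have XL : 0 <= X%:R * L by rewrite mulr_ge0 // ltW.
lra.
Qed.

End Assembly.

Lemma ler_ln (x y : R) : 0 < x -> x <= y -> ln x <= ln y.
Proof.
move=> /RltP x0; rewrite le_eqVlt => /orP [/eqP ->//|/RltP xy].
by apply/RleP/Rlt_le/ln_increasing.
Qed.

Lemma ln_gt0 (x : R) : 1 < x -> 0 < ln x.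
Proof. move=> /RltP x1; have := ln_increasing 1 x Rlt_0_1 x1.
by rewrite ln_1 => h; apply/RltP. Qed.

(** With z = ln y the claim is g ln z <= z / 2. It follows from ln z <= 2 sqrt z and 4 g <= sqrt z,
    the latter being z >= 16 g^2. *)
Lemma Rpower_ln_le_sqrt (g y : R) : 0 < g -> exp (16 * g ^+ 2 + 1)%R <= y ->
  Rpower (ln y) g <= Num.sqrt y.
Proof.
move=> g0 hy; set z := ln y.
have y0 : 0 < y by apply: lt_le_trans hy; apply/RltP; exact: exp_pos.
have zge : 16 * g ^+ 2 + 1 <= z.
  by rewrite -[leLHS]ln_exp; apply: ler_ln => //; apply/RltP; exact: exp_pos.
have g2 : 0 <= g ^+ 2 by exact: sqr_ge0.
have z1 : 1 <= z by lra.
have z0 : 0 < z by lra.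
pose u := Num.sqrt z.
have u0 : 0 < u by rewrite sqrtr_gt0.
have uE : u ^+ 2 = z by rewrite sqr_sqrtr // ltW.
have ug : 4 * g <= u.
  rewrite -(@ler_pXn2r _ 2) ?nnegrE ?mulr_ge0 ?(ltW g0) ?(ltW u0) // uE exprMn.
  by rewrite -natrX; apply: le_trans zge; lra.
have lnz : ln z <= 2 * u.
  have -> : ln z = ln u + ln u.
    rewrite -uE expr2; apply: ln_mult; exact/RltP.
  have : ln u <= u.
    have : ln u <= ln (exp u).
      apply: ler_ln => //.
      have h : 1 + u < exp u by apply/RltP; apply: exp_ineq1; apply/eqP; rewrite gt_eqF.
      lra.
    by rewrite ln_exp.
  lra.
pose h := z / 2.
have hh : h + h = z by rewrite /h; lra.
have E : exp h ^+ 2 = y.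
  by rewrite expr2 expRD RplusE hh; apply: exp_ln; apply/RltP.
rewrite -E sqrtr_sqr ger0_norm; last by apply/RleP/Rlt_le/exp_pos.
rewrite /Rpower.
have : g * ln z <= h.
  have h1 : g * ln z <= g * (2 * u) by rewrite ler_wpM2l // ltW.
  have h2 : 4 * g * u <= u * u by rewrite ler_wpM2r // ltW.
  rewrite -expr2 uE in h2; rewrite /h; lra.
rewrite le_eqVlt RmultE => /orP [/eqP ->//|/RltP hlt].
by apply/RleP/Rlt_le/exp_increasing.
Qed.

(** With u = (s - 1) / 2 rounded down, 146 s + 86 <= 292 u + 378 <= 2^u for u >= 15; then square. *)
Lemma quad_le_pow s : (31 <= s)%N -> ((146 * s + 86) ^ 2 <= 2 ^ s.-1)%N.
Proof.
move=> s31.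
have H v : (292 * (v + 15) + 378 <= 2 ^ (v + 14))%N.
  elim: v => [|v IH]; last first.
    have -> : (v.+1 + 14 = (v + 14).+1)%N by [].
    by rewrite expnS mul2n -addnn; apply: leq_trans (leq_add IH IH); clear; lia.
  have E : (2 ^ 7 = 128)%N by [].
  by rewrite add0n add0n (expnD 2 7 7) E; clear; lia.
have [u uE] : exists u, u = (s.-1 %/ 2)%N by exists (s.-1 %/ 2)%N.
have u15 : (15 <= u)%N by rewrite uE leq_divRL // -ltnS prednK // (leq_trans _ s31).
have su : (s <= 2 * u + 2)%N.
  have := ltn_ceil s.-1 (isT : 0 < 2)%N; rewrite -uE; move: s31; clear; lia.
have {}H := H (u - 15)%N; rewrite subnK // in H.
have h : (146 * s + 86 <= 2 ^ u)%N.
  apply: leq_trans (_ : 2 ^ (u - 15 + 14) <= _)%N; last by rewrite leq_exp2l //; move: u15; clear; lia.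
  apply: leq_trans H; move: su u15; clear; lia.
apply: leq_trans (_ : (2 ^ u) ^ 2 <= _)%N; first by rewrite leq_exp2r.
by rewrite -expnM leq_exp2l // uE leq_trunc_div.
Qed.

Lemma lnn2_lt1 : lnn 2 < 1.
Proof.
have h : 1 + 1 < exp 1.
  by apply/RltP; apply: exp_ineq1; apply/eqP; exact: oner_neq0.
apply/RltP; rewrite -[X in Rlt _ X]ln_exp; apply: ln_increasing; apply/RltP.
  by rewrite ltr0n.
exact: h.
Qed.

Lemma lnn2_gt : 1 / 2 < lnn 2.
Proof. by have := ln_lt_2 => /RltP; rewrite RinvE div1r. Qed.

(** Take w maximal. Failure at w + 1 bounds t by (16 * 5^(w+1))^4 <= 2^(4 (4 + 3 (w+1))), using 5 <=
    2^3; thus w is at least of order log t. *)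
Lemma exists_scale (t W : nat) : ((16 * 5 ^ W) ^ 4 <= t)%N ->
  exists w, [/\ (W <= w)%N, ((16 * 5 ^ w) ^ 4 <= t)%N & (t < 2 ^ (28 + 12 * w))%N].
Proof.
move=> Wt; pose P w := ((16 * 5 ^ w) ^ 4 <= t)%N.
have Pt w : P w -> (w <= t)%N.
  move=> h; apply: leq_trans h; apply: leq_trans (ltnW (ltn_expl w (isT : 1 < 5)%N)) _.
  apply: leq_trans (_ : 16 * 5 ^ w <= _)%N; first exact: leq_pmull.
  by rewrite -[X in (X <= _)%N]expn1 leq_pexp2l // muln_gt0 expn_gt0.
have exP : exists w, P w by exists W.
case: (ex_maxnP exP Pt) => w Pw wmax; exists w; split => //; first exact: wmax.
have : ~~ P w.+1 by apply/negP => /wmax; rewrite ltnn.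
rewrite /P -ltnNge => h; apply: leq_trans h _.
have -> : (28 + 12 * w = (4 + 3 * w.+1) * 4)%N by clear; lia.
by rewrite expnM leq_exp2r // expnD expnM leq_mul // leq_exp2r.
Qed.

Lemma kloosterman_mult_bound (g : R) : 0 < g -> exists t0 : nat,
  forall (q : nat) (a b : 'F_q) (X : nat) (f : nat -> R[i]),
  prime q -> (2 ^ t0 <= q)%N -> a != 0 -> (forall n, normc (f n) <= 1) ->
  (forall m n, coprime m n -> f (m * n)%N = f m * f n) ->
  (X <= q)%N -> (q <= X ^ 2)%N ->
  0 < Rpower (ln (ln (ln (q%:R)%R))) g /\
  normc (\sum_(1 <= n < X.+1) f n * psi (a / n%:R + b * n%:R)) *
    Rpower (ln (ln (ln (q%:R)%R))) g <= 562 * X%:R.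
Proof.
move=> g0; pose W := Num.bound (exp (16 * g ^+ 2 + 1)%R).
have hW : exp (16 * g ^+ 2 + 1)%R < W%:R.
  by apply: archi_boundP; apply/RleP/Rlt_le/exp_pos.
have W0 : (0 < W)%N.
  by rewrite -(ltr0n R); apply: lt_trans hW; apply/RltP; exact: exp_pos.
(* The first bound forces w >= W, so that (ln y)^g <= sqrt y below. The second gives ln q >= 2^30
   and s >= 31, hence a positive triple logarithm and the quadratic condition on s. *)
have [t0 [t0W t031]] : exists t0, ((16 * 5 ^ W) ^ 4 <= t0)%N /\ (2 ^ 31 <= t0)%N.
  by exists (maxn ((16 * 5 ^ W) ^ 4) (2 ^ 31)); split; [exact: leq_maxl | exact: leq_maxr].
exists t0 => q a b X f pq t0q a0 f1 fM Xq qX.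
have q0 := prime_gt0 pq.
have [t [qt tq]] : exists t, (q < 2 ^ t)%N /\ (2 ^ t <= 2 * q)%N.
  exists (trunc_log 2 q).+1; rewrite trunc_log_ltn //; split => //.
  by rewrite expnS leq_mul2l trunc_logP.
have t0t : (t0 < t)%N by rewrite -(@ltn_exp2l 2) //; exact: leq_ltn_trans t0q qt.
have tpos : (0 < t)%N by apply: leq_ltn_trans t0t.
have [s [ts st]] : exists s, (t < 2 ^ s)%N /\ (2 ^ s.-1 <= t)%N.
  by exists (trunc_log 2 t).+1; rewrite trunc_log_ltn // trunc_logP.
have s31 : (31 <= s)%N.
  by rewrite -(@leq_exp2l 2) //; apply: leq_trans t031 (leq_trans (ltnW t0t) (ltnW ts)).
have sst := leq_trans (quad_le_pow s31) st.
have [w [Ww wt tw]] := exists_scale (leq_trans t0W (ltnW t0t)).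
have w0 : (0 < w)%N by exact: leq_trans Ww.
have H := kloosterman_mult_le pq b a0 f1 fM Xq qX qt tq (ltnW ts) w0 wt sst.
set S := normc _ in H *; have S0 : 0 <= S by exact: normc_ge0.
have l1 := lnn2_lt1; have l2 := lnn2_gt.
rewrite -[ln q%:R]/(lnn q).
have up1 : lnn q <= t%:R.
  apply: le_trans (lnn_le q0 (ltnW qt)) _; rewrite lnnX //.
  by rewrite ler_piMr ?ler0n // ltW.
have lo1 : (2 ^ 30)%N%:R <= lnn q.
  apply: le_trans (lnn_le _ t0q); rewrite ?expn_gt0 // lnnX //.
  apply: le_trans (_ : t0%:R * (1 / 2) <= _); last by rewrite ler_wpM2l ?ler0n // ltW.
  rewrite mul1r ler_pdivlMr // -natrM ler_nat mulnC -expnS; exact: t031.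
have lo1p : 0 < lnn q by apply: lt_le_trans lo1; rewrite ltr0n expn_gt0.
have lo2 : 15 <= ln (lnn q).
  apply: le_trans (_ : lnn (2 ^ 30) <= _); last by apply: ler_ln lo1; rewrite ltr0n expn_gt0.
  by rewrite lnnX //; clear -l2; lra.
clear lo1 t031 s31.
have lo3 : 0 < ln (ln (lnn q)) by apply: ln_gt0; lra.
(* From ln q <= t < 2^(28 + 12 w), y dominates ln ln q and ln y dominates the triple logarithm. *)
pose y : R := (28 + 12 * w)%N%:R.
have up2 : ln (lnn q) <= y.
  apply: le_trans (_ : lnn t <= _); first exact: ler_ln.
  apply: le_trans (lnn_le tpos (ltnW tw)) _; rewrite lnnX //.
  by rewrite ler_piMr ?ler0n // ltW.
have up3 : ln (ln (lnn q)) <= ln y by apply: ler_ln => //; lra.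
split; first by apply/RltP; exact: exp_pos.
have rp : Rpower (ln (ln (lnn q))) g <= Num.sqrt y.
  apply: le_trans (_ : Rpower (ln y) g <= _).
    apply/RleP; apply: Rle_Rpower_l; first exact/RleP/ltW.
    by split; [exact/RltP | exact/RleP].
  apply: Rpower_ln_le_sqrt => //; apply: le_trans (ltW hW) _.
  rewrite /y ler_nat; apply: leq_trans Ww _; clear; lia.
(* As w >= 1, 28 + 12 w <= 45 w = 30^2 w / 20. The final constant is 30 * 5 = 150, within 562. *)
have sy : Num.sqrt y <= 30 * Num.sqrt (w%:R / 20).
  apply: le_trans (_ : Num.sqrt (30 ^+ 2 * (w%:R / 20)) <= _).
    apply: ler_wsqrtr; rewrite /y natrD natrM.
    have : 1 <= w%:R :> R by rewrite ler1n.
    lra.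
  by rewrite sqrtrM ?sqr_ge0 // sqrtr_sqr ger0_norm.
apply: le_trans (ler_wpM2l S0 (le_trans rp sy)) _.
have X0 : 0 <= X%:R :> R by rewrite ler0n.
rewrite mulrCA; lra.
Qed.

(** * Translation to the Stdlib and Coquelicot setting *)

Require Import Defs.
From Stdlib Require Import Reals ZArith Znumtheory.
From Coquelicot Require Import Coquelicot.
Local Open Scope ring_scope.
Local Open Scope complex_scope.

Definition toC (z : C) : R[i] := Complex z.1 z.2.

Lemma normc_toC z : normc (toC z) = Cmod z.
Proof. by rewrite /Cmod RsqrtE !RpowE. Qed.

Lemma toC_mul (z w : C) : toC (Cmult z w) = toC z * toC w.
Proof. by []. Qed.

Lemma toC_sum_n (g : nat -> C) N : toC (sum_n g N) = \sum_(0 <= n < N.+1) toC (g n).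
Proof.
elim: N => [|N IH]; first by rewrite sum_O big_nat1.
by rewrite sum_Sn big_nat_recr //= -IH.
Qed.

Lemma expi_IZR (z : Z) : expi (IZR z) = 1.
Proof.
have pos n : expi (IZR (Z.of_nat n)) = 1 by rewrite -INR_IZR_INZ INRE expi_nat.
case: (Z_le_gt_dec 0 z) => h; first by rewrite -(Z2Nat.id z) // pos.
have : expi (IZR (- z)) = 1 by rewrite -(Z2Nat.id (- z)) ?pos //; Lia.lia.
rewrite opp_IZR RoppE => e1.
have : expi (IZR z) * expi (- IZR z) = 1 by rewrite -expiD subrr expi0.
by rewrite e1 mulr1.
Qed.

Lemma prime_Z_nat (n : nat) : Znumtheory.prime (Z.of_nat n) -> prime.prime n.
Proof.
move=> pn; have n1 : (1 < Z.of_nat n)%Z by case: pn.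
apply/primeP; split; first by apply/ssrnat.ltP; Lia.lia.
move=> d /dvdnP [k E].
have : (Z.of_nat d | Z.of_nat n)%Z by exists (Z.of_nat k); rewrite E; Lia.lia.
move/(prime_divisors _ pn) => H; apply/orP.
by case: H => [|[|[]]] H; [|left|right|]; try apply/eqP; Lia.lia.
Qed.

Section Residues.
Variables (q : nat) (pq : prime.prime q).

Definition resF (v : Z) : 'F_q := (Z.to_nat (v mod Z.of_nat q))%:R.

Let q0 : (0 < Z.of_nat q)%Z.
Proof. by have := prime_gt0 pq => /ssrnat.ltP; Lia.lia. Qed.

Lemma resF_eq (v : Z) (k : nat) : (v mod Z.of_nat q = Z.of_nat k mod Z.of_nat q)%Z -> resF v = k%:R.
Proof.
move=> E; rewrite /resF E -Nat2Z.inj_mod Nat2Z.id.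
rewrite [in RHS](Nat.div_mod_eq k q) !plusE !multE natrD natrM.
by rewrite [q%:R](_ : _ = 0) ?mul0r ?add0r //; apply: pchar_Fp_0.
Qed.

Lemma resF_nat (k : nat) : resF (Z.of_nat k) = k%:R.
Proof. exact: resF_eq. Qed.

Lemma resFE (v : Z) : Z.of_nat (Z.to_nat (v mod Z.of_nat q)) = (v mod Z.of_nat q)%Z.
Proof. by rewrite Z2Nat.id //; have := Z.mod_pos_bound v _ q0; Lia.lia. Qed.

Lemma resFD (u v : Z) : resF (u + v) = resF u + resF v.
Proof.
rewrite {2 3}/resF -natrD; apply: resF_eq.
by rewrite -plusE Nat2Z.inj_add !resFE -Zplus_mod.
Qed.

Lemma resFM (u v : Z) : resF (u * v) = resF u * resF v.
Proof.
rewrite {2 3}/resF -natrM; apply: resF_eq.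
by rewrite -multE Nat2Z.inj_mul !resFE -Zmult_mod.
Qed.

Lemma resF_eq0 (v : Z) : resF v = 0 -> (v mod Z.of_nat q = 0)%Z.
Proof.
move/eqP; rewrite /resF -(dvdn_pcharf (pchar_Fp pq)) => /dvdnP [k E].
have := Z.mod_pos_bound v _ q0; rewrite -resFE E.
case: k {E} => [//|k]; Lia.nia.
Qed.

Lemma toC_e_q (v : Z) : toC (e_q (Z.of_nat q) v) = psi (resF v).
Proof.
rewrite psi_nat //.
have -> : toC (e_q (Z.of_nat q) v) = expi (IZR v / IZR (Z.of_nat q)).
  by rewrite /toC /e_q /expi /= !RealsE mulrA.
have qn0 : IZR (Z.of_nat q) != 0 by rewrite -INR_IZR_INZ INRE pnatr_eq0 -lt0n prime_gt0.
have E := Z.div_mod v (Z.of_nat q) (Z.neq_sym _ _ (Z.lt_neq _ _ q0)).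
rewrite [in LHS]E plus_IZR mult_IZR !RealsE mulrDl mulrAC mulfV // mul1r expiD expi_IZR mul1r.
by rewrite -!INRE !INR_IZR_INZ resFE.
Qed.

End Residues.

(** For prime q, among the indices 0, ..., q the conditions remove only 0 and q, hence the cut at q
    - 1. *)
Lemma toC_twisted_sum (q : nat) (pq : prime.prime q) (a b : Z) (inv : Z -> Z) (f : nat -> C) (x : R) :
  Znumtheory.prime (Z.of_nat q) ->
  (forall n : Z, Z.gcd n (Z.of_nat q) = 1%Z -> (n * inv n mod Z.of_nat q = 1 mod Z.of_nat q)%Z) ->
  (Z.to_nat (Int_part x) <= q)%nat ->
  toC (twisted_sum f inv (Z.of_nat q) a b x) =
  \sum_(1 <= n < (minn (Z.to_nat (Int_part x)) q.-1).+1)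
     toC (f n) * psi (resF q a / n%:R + resF q b * n%:R).
Proof.
move=> qZ hinv; rewrite /twisted_sum toC_sum_n; move: (Z.to_nat (Int_part x)) => N Nq.
have q1 := prime_gt1 pq.
pose G (n : nat) := toC (if andb (Nat.leb 1 n) (Z.eqb (Z.gcd (Z.of_nat n) (Z.of_nat q)) 1%Z)
  then Cmult (f n) (e_q (Z.of_nat q) (a * inv (Z.of_nat n) + b * Z.of_nat n)%Z) else RtoC 0).
rewrite -[LHS]/(\sum_(0 <= n < N.+1) G n).
pose F n := toC (f n) * psi (resF q a / n%:R + resF q b * n%:R).
have GE n : (1 <= n < q)%nat -> G n = F n.
  move=> /andP [n1 nq]; rewrite /G.
  have g1 : Z.gcd (Z.of_nat n) (Z.of_nat q) = 1%Z.
    apply/Zgcd_1_rel_prime; apply: rel_prime_le_prime => //.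
    by move: n1 nq => /ssrnat.leP h1 /ssrnat.ltP h2; Lia.lia.
  have -> : Nat.leb 1 n = true by apply/Nat.leb_le/ssrnat.leP.
  rewrite g1 /= toC_mul toC_e_q // /F; congr (_ * psi _).
  have n0 : n%:R != 0 :> 'F_q by rewrite natF_neq0 // n1 nq.
  have -> : n%:R^-1 = resF q (inv (Z.of_nat n)).
    apply: (mulfI n0); rewrite mulfV // -resF_nat // -resFM //.
    by rewrite (resF_eq pq (k := 1)) //; exact: hinv.
  by rewrite resFD // !resFM // resF_nat.
have G0 : G 0%nat = 0 by [].
rewrite big_ltn // G0 add0r.
case: (ltnP N q) => [Nltq|qN].
  have Nq1 : (N <= q.-1)%nat by rewrite -ltnS prednK // ltnW.
  rewrite (minn_idPl Nq1).
  rewrite big_nat_cond [RHS]big_nat_cond; apply: eq_bigr => n /andP [/andP [n1 nN] _].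
  by apply: GE; rewrite n1 (leq_trans nN).
have -> : N = q by apply/eqP; rewrite eqn_leq Nq.
have -> : minn q q.-1 = q.-1 by apply/minn_idPr; exact: leq_pred.
rewrite prednK ?(ltnW q1) // big_nat_recr ?(ltnW q1) //=.
have -> : G q = 0.
  rewrite /G; have -> : (Z.gcd (Z.of_nat q) (Z.of_nat q) =? 1)%Z = false.
    by apply/Z.eqb_neq; rewrite Z.gcd_diag; move: q1 => /ssrnat.ltP; Lia.lia.
  by rewrite andbF.
rewrite addr0 big_nat_cond [RHS]big_nat_cond; apply: eq_bigr => n /andP [nn _].
exact: GE.
Qed.

Open Scope R_scope.

Lemma toC_multiplicative (f : nat -> C) (m n : nat) : multiplicative f -> coprime m n ->
  toC (f (muln m n)) = GRing.mul (toC (f m)) (toC (f n)).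
Proof.
move=> [_ fM] co; rewrite -toC_mul -multE (fM m n) //.
have d : dvdn (Nat.gcd m n) (gcdn m n).
  rewrite dvdn_gcd; apply/andP; split; apply/dvdnP.
    by have [k E] := Nat.gcd_divide_l m n; exists k; exact: E.
  by have [k E] := Nat.gcd_divide_r m n; exists k; exact: E.
by move: d; rewrite (eqP co) dvdn1 => /eqP.
Qed.

Lemma sqrt_ge1 (x : R) : 1 <= x -> 1 <= sqrt x.
Proof. by move=> h; rewrite -sqrt_1; apply: sqrt_le_1_alt. Qed.

(** The factor 2 pays for the floor and for the cut at q - 1: both x - 1 and q - 1 are at least 2
    sqrt q - 1 >= sqrt q. *)
Lemma floor_range (q : nat) (x : R) : (0 < q)%nat ->
  2 * sqrt (INR q) <= x -> x <= INR q ->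
  let N := Z.to_nat (Int_part x) in
  leq N q /\ leq q (expn (minn N q.-1) 2) /\ INR (minn N q.-1) <= x.
Proof.
move=> q0 hx xq N.
have q1 : 1 <= INR q by have := le_INR 1 q; apply; apply/ssrnat.leP.
have s1 := sqrt_ge1 q1.
have ss := sqrt_sqrt (INR q) ltac:(Lra.lra).
have [i1 i2] := base_Int_part x.
have Nx : INR N = IZR (Int_part x).
  rewrite INR_IZR_INZ Z2Nat.id //; apply: le_IZR; Lra.nra.
have Nq : leq N q by apply/ssrnat.leP; apply: INR_le; Lra.lra.
have mx : INR (minn N q.-1) <= x.
  apply: Rle_trans (_ : INR N <= x); last by Lra.lra.
  by apply: le_INR; apply/ssrnat.leP; exact: geq_minl.
split => //; split => //.
have ms : sqrt (INR q) <= INR (minn N q.-1).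
  rewrite /minn; case: ifP => _; first by Lra.lra.
  have -> : INR q.-1 = INR q - 1 by rewrite -{2}(prednK q0) S_INR; Lra.lra.
  Lra.nra.
apply/ssrnat.leP; apply: INR_le; rewrite -mulnn -multE mult_INR; Lra.nra.
Qed.

Theorem theorem4 :
  forall gamma : R, 0 < gamma ->
  exists q4 : R,
  forall (q a b : Z) (inv : Z -> Z) (f : nat -> C) (x : R),
    prime q -> q4 <= IZR q ->
    Z.gcd a q = 1%Z ->
    (forall n : Z, Z.gcd n q = 1%Z -> (n * inv n mod q = 1 mod q)%Z) ->
    multiplicative f ->
    (forall n : nat, Cmod (f n) <= 1) ->
    sqrt (IZR q) * ln (IZR q) * exp (Rpower (lll q) (1 + gamma)) <= x ->
    x <= IZR q ->
    Cmod (twisted_sum f inv q a b x) <= 562 * x / Rpower (lll q) gamma.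
Proof.
move=> gamma /RltP gamma0.
have [t0 H] := kloosterman_mult_bound gamma0.
(* The second entry ensures ln q >= 2, which supplies the factor 2 in x >= 2 sqrt q. *)
exists (Rmax (INR (expn 2 t0)) (exp 2)) => q a b inv f x.
move=> qZ hq ga hinv fM f1 hx xq.
have q2 : (2 <= q)%Z by case: (qZ); Lia.lia.
have [n nE] : exists n, q = Z.of_nat n by exists (Z.to_nat q); rewrite Z2Nat.id //; Lia.lia.
subst q; move: hq hx xq; rewrite -INR_IZR_INZ => hq hx xq.
have pq : prime.prime n by exact: prime_Z_nat.
have n0 : (0 < n)%nat by exact: prime_gt0.
have hq1 : INR (expn 2 t0) <= INR n := Rle_trans _ _ _ (Rmax_l _ _) hq.
have hq2 : exp 2 <= INR n := Rle_trans _ _ _ (Rmax_r _ _) hq.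
have ln2 : 2 <= ln (INR n).
  have e0 := exp_pos 2; rewrite -[X in X <= _]ln_exp.
  by case: hq2 => [h|<-]; [left; apply: ln_increasing | right].
have ex1 : 1 <= exp (Rpower (lll (Z.of_nat n)) (1 + gamma)).
  rewrite -[X in X <= _]exp_0; left; apply: exp_increasing; exact: exp_pos.
have hx2 : 2 * sqrt (INR n) <= x.
  apply: Rle_trans hx; have s0 := sqrt_pos (INR n).
  have h : 2 * 1 <= ln (INR n) * exp (Rpower (lll (Z.of_nat n)) (1 + gamma)).
    by apply: Rmult_le_compat; Lra.lra.
  rewrite Rmult_assoc; Lra.nra.
have [Nn [nX Xx]] := floor_range n0 hx2 xq.
set X := minn _ _ in nX Xx.
have tq : leq (expn 2 t0) n by apply/ssrnat.leP; exact: INR_le.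
have a0 : resF n a != GRing.zero.
  apply/eqP => /(resF_eq0 pq) am.
  have dv : (Z.of_nat n | Z.gcd a (Z.of_nat n))%Z.
    apply: Z.gcd_greatest; last exact: Z.divide_refl.
    by apply/Z.mod_divide => //; Lia.lia.
  rewrite ga in dv; have := Z.divide_pos_le _ _ Z.lt_0_1 dv; Lia.lia.
have Xn : leq X n by apply: leq_trans Nn; exact: geq_minl.
have f1' m : is_true (Order.le (normc (toC (f m))) (GRing.one _)).
  by apply/RleP; rewrite normc_toC; exact: f1.
have [P0 B] := H n (resF n a) (resF n b) X (fun m => toC (f m)) pq tq a0 f1'
  (fun u v => @toC_multiplicative f u v fM) Xn nX.
rewrite -(toC_twisted_sum pq a b f qZ hinv Nn) normc_toC in B.
have lE : ln (ln (ln (Algebra.natmul (GRing.one _) n))) = lll (Z.of_nat n).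
  by rewrite /lll -INR_IZR_INZ INRE.
rewrite lE in B P0; move/RltP in P0; move/RleP in B.
rewrite -!INRE in B.
apply: (Rmult_le_reg_r _ _ _ P0).
rewrite /Rdiv Rmult_assoc Rinv_l ?Rmult_1_r; last by apply: Rgt_not_eq.
apply: Rle_trans B _.
have e562 : INR 562 = 562 by rewrite INR_IZR_INZ.
rewrite e562; apply: Rmult_le_compat_l => //; Lra.lra.
Qed.
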